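(* Let $D\subset\mathbb{C}$ be a domain and let $f:D\to\mathbb{C}$ be continuous. Suppose that, for every $a\in D$, there is $\delta(a)>0$ such that $$J_f(a,r)=\int_{C(a,r)}f(\zeta)\,d\zeta=0\qquad\text{whenever }0<r<\min\{\delta(a),\rho_D(a)\}.$$ Then $f$ is holomorphic in $D$.
   Context: A domain is a connected open subset of $\mathbb{C}$. For $a\in\mathbb{C}$ and $r>0$, $C(a,r)=\{z\in\mathbb{C}:|z-a|=r\}$ is the positively oriented circle, so that $J_f(a,r)=\int_{C(a,r)}f(\zeta)\,d\zeta=\int_0^{2\pi}f(a+re^{it})\,ire^{it}\,dt$. For $a\in D$, $\rho_D(a)=\operatorname{dist}(a,\partial D)$, with the convention $\rho_D(a)=\infty$ when $D=\mathbb{C}$. *)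

(* Defs.v *)
From Stdlib Require Import Reals.
From Coquelicot Require Import Coquelicot.

Open Scope R_scope.

Definition connected (A : C -> Prop) : Prop :=
  ~ exists U V : C -> Prop,
      open U /\ open V /\
      (forall z, A z -> U z \/ V z) /\
      (forall z, A z -> ~ (U z /\ V z)) /\
      (exists z, A z /\ U z) /\ (exists z, A z /\ V z).

Definition is_domain (D : C -> Prop) : Prop := open D /\ connected D.

Definition boundary (A : C -> Prop) (z : C) : Prop :=
  forall U : C -> Prop, locally z U ->
    (exists w, U w /\ A w) /\ (exists w, U w /\ ~ A w).

(* Infimum in the extended reals: it is [p_infty] when the boundary is empty,
   which for a nonempty domain [D] happens exactly when [D] is the plane. *)
Definition rho (D : C -> Prop) (a : C) : Rbar :=
  Glb_Rbar (fun d : R => exists w : C, boundary D w /\ d = Cmod (w - a)).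

Definition expi (t : R) : C := (cos t, sin t).

(* The integral of [f] over the positively oriented circle [C(a, r)].  [RInt]
   is total; its value is meaningful as soon as [f] is continuous on the
   circle. *)
Definition J (f : C -> C) (a : C) (r : R) : C :=
  RInt (V := C_R_CompleteNormedModule)
    (fun t : R => Cmult (f (a + r * expi t)%C) (Ci * r * expi t)%C)
    0 (2 * PI).

Definition holomorphic_on (D : C -> Prop) (f : C -> C) : Prop :=
  forall z : C, D z -> ex_derive (K := C_AbsRing) (V := C_NormedModule) f z.

(* Main.v *)
(** Cut [f] off near a point and let [w] be the area integral of
    [f(a + s e^(it)) e^(it)] in the polar coordinates [ds dt], which is, up to a
    constant, the solution of [dw/dz = f] given by the conjugate Cauchy kernel.
    The derivative in [r] of the mean of [w] over [C(a, r)] is a multiple of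
    [J_f(a, r) / r]; so the hypothesis says exactly that [w] has the mean value
    property on all sufficiently small circles about each point, with no
    uniformity in the radius.  This is what the maximum principle needs:
    comparing [w] with Poisson integrals shows that [w] is the Poisson integral
    of its values on a circle.  Then [f], a multiple of [dw/dz], is a
    Cauchy-type integral, hence holomorphic. *)

Require Import Defs.
From Stdlib Require Import Reals Lra ClassicalEpsilon FunctionalExtensionality.
From Coquelicot Require Import Coquelicot.

Open Scope R_scope.

(** The obstacle is that [f] is only continuous, so [w] need not be differentiable a priori and
    [dw/dz] cannot be computed directly. For a real density [g], the field
    [V = (pot g cos, pot g sin)] is minus the gradient of the logarithmic potential of [g]: its
    divergence is [- 2 PI g], its curl is zero. The consequences that survive without derivatives
    are the means of [V] over circles, its flux and its circulation. They are proved for C1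
    densities and extended to continuous ones by Steklov averages. Differentiability of [w] is
    obtained only afterwards, from its Poisson integral; comparing fluxes through shrinking circles
    then identifies [dw/dz] with [- PI f]. The sizes nest: after rescaling, the density agrees with
    [f] on the square of half-side 1, is supported in half-side 2, and its averages in half-side
    3. *)

(** * Continuity of functions of several real variables *)

Definition cont2 (g : R -> R -> R) : Prop :=
  forall p : R * R, continuous (fun q => g (fst q) (snd q)) p.

(** [T] carries a smoothing parameter. Continuity jointly with that parameter is what later allows
    it to tend to 0 inside every integral. *)
Definition jcont {T : UniformSpace} (G : T -> R -> R -> R) : Prop :=
  forall q : (T * R) * R,
    continuous (fun q : (T * R) * R => G (fst (fst q)) (snd (fst q)) (snd q)) q.

Lemma cont2_comp {T : UniformSpace} (g : R -> R -> R) (X Y : T -> R) (p : T) :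
  cont2 g -> continuous X p -> continuous Y p ->
  continuous (fun q => g (X q) (Y q)) p.
Proof.
  intros Hg HX HY.
  exact (continuous_comp_2 X Y g p HX HY (Hg (X p, Y p))).
Qed.

Lemma continuous_Rplus {T : UniformSpace} (f g : T -> R) (p : T) :
  continuous f p -> continuous g p -> continuous (fun q => f q + g q) p.
Proof. intros Hf Hg. exact (continuous_plus f g p Hf Hg). Qed.

Lemma continuous_Rminus {T : UniformSpace} (f g : T -> R) (p : T) :
  continuous f p -> continuous g p -> continuous (fun q => f q - g q) p.
Proof. intros Hf Hg. exact (continuous_minus f g p Hf Hg). Qed.

Lemma continuous_Ropp {T : UniformSpace} (f : T -> R) (p : T) :
  continuous f p -> continuous (fun q => - f q) p.
Proof. intros Hf. exact (continuous_opp f p Hf). Qed.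

Lemma continuous_Rmult {T : UniformSpace} (f g : T -> R) (p : T) :
  continuous f p -> continuous g p -> continuous (fun q => f q * g q) p.
Proof. intros Hf Hg. exact (continuous_mult f g p Hf Hg). Qed.

Lemma continuous_Rdiv {T : UniformSpace} (f g : T -> R) (p : T) :
  continuous f p -> continuous g p -> g p <> 0 ->
  continuous (fun q => f q / g q) p.
Proof.
  intros Hf Hg H0. apply continuous_Rmult; [exact Hf|].
  apply (continuous_comp g Rinv); [exact Hg|].
  now apply continuous_Rinv.
Qed.

Lemma continuous_cos_comp {T : UniformSpace} (f : T -> R) (p : T) :
  continuous f p -> continuous (fun q => cos (f q)) p.
Proof.
  intros Hf. exact (continuous_comp f cos p Hf (continuous_cos _)).
Qed.

Lemma continuous_sin_comp {T : UniformSpace} (f : T -> R) (p : T) :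
  continuous f p -> continuous (fun q => sin (f q)) p.
Proof.
  intros Hf. exact (continuous_comp f sin p Hf (continuous_sin _)).
Qed.

Lemma continuous_fst_comp {T U V : UniformSpace} (f : T -> U * V) (p : T) :
  continuous f p -> continuous (fun q => fst (f q)) p.
Proof.
  intros Hf. apply (continuous_comp f fst); [exact Hf|].
  destruct (f p). apply continuous_fst.
Qed.

Lemma continuous_snd_comp {T U V : UniformSpace} (f : T -> U * V) (p : T) :
  continuous f p -> continuous (fun q => snd (f q)) p.
Proof.
  intros Hf. apply (continuous_comp f snd); [exact Hf|].
  destruct (f p). apply continuous_snd.
Qed.

Lemma continuous_pair {T U V : UniformSpace} (f : T -> U) (g : T -> V) (p : T) :
  continuous f p -> continuous g p -> continuous (fun q => (f q, g q)) p.
Proof.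
  intros Hf Hg. apply (continuous_comp_2 f g (fun a b => (a, b))); auto.
  apply continuous_ext with (f := fun x => x);
    [intros [? ?]; reflexivity | apply continuous_id].
Qed.

Lemma continuous_comp_R {T : UniformSpace} (k : R -> R) (f : T -> R) (p : T) :
  (forall t, continuous k t) -> continuous f p -> continuous (fun q => k (f q)) p.
Proof. intros Hk Hf. exact (continuous_comp f k p Hf (Hk _)). Qed.

Ltac eqR := match goal with |- @eq _ ?a ?b => change (@eq R a b) end.

(** Follows the syntax of the function and leaves open whatever it does not recognise, such as
    quotients. *)
Ltac cont :=
  cbv beta;
  lazymatch goal with
  | |- cont2 _ => assumption
  | |- jcont _ => assumption
  | |- forall _, continuous _ _ => intro; cont
  | H : continuous ?f ?p |- continuous ?f ?p => exact H
  | H : forall q, continuous ?f q |- continuous ?f _ => apply H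
  | |- continuous (fun _ => ?c) _ => apply continuous_const
  | |- continuous (fun q => q) _ => apply continuous_id
  | |- continuous (fun q => @?f q + @?g q) _ => apply (continuous_Rplus f g); cont
  | |- continuous (fun q => @?f q - @?g q) _ => apply (continuous_Rminus f g); cont
  | |- continuous (fun q => @?f q * @?g q) _ => apply (continuous_Rmult f g); cont
  | |- continuous (fun q => - @?f q) _ => apply (continuous_Ropp f); cont
  | |- continuous (fun q => cos (@?f q)) _ => apply (continuous_cos_comp f); cont
  | |- continuous (fun q => sin (@?f q)) _ => apply (continuous_sin_comp f); cont
  | |- continuous cos _ => apply continuous_cos
  | |- continuous sin _ => apply continuous_sin
  | |- continuous (fun q => fst q) _ => apply (continuous_fst_comp (fun q => q)); cont
  | |- continuous (fun q => snd q) _ => apply (continuous_snd_comp (fun q => q)); cont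
  | |- continuous fst _ => apply (continuous_fst_comp (fun q => q)); cont
  | |- continuous snd _ => apply (continuous_snd_comp (fun q => q)); cont
  | |- continuous (fun q => fst (@?f q)) _ => apply (continuous_fst_comp f); cont
  | |- continuous (fun q => snd (@?f q)) _ => apply (continuous_snd_comp f); cont
  | |- continuous (fun q => (@?f q, @?g q)) _ => apply (continuous_pair f g); cont
  | H : cont2 ?g |- continuous (fun q => ?g (@?f q) (@?h q)) _ =>
      apply (cont2_comp g f h); [exact H | cont | cont]
  | H : forall t, continuous ?k t |- continuous (fun q => ?k (@?f q)) _ =>
      apply (continuous_comp_R k f); [exact H | cont]
  | _ => idtac
  end.

(** * Integrals depending on a parameter *)

(** Compactness of [[a, b]] makes continuity at the points of [{p} x [a, b]] uniform in [t].
    Continuity and differentiation under the integral, and uniform continuity on the circle, all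
    come from here. *)
Lemma tube {T : UniformSpace} (F : T -> R -> R) (a b : R) (p : T) :
  (forall t, a <= t <= b ->
     continuous (fun q : T * R => F (fst q) (snd q)) (p, t)) ->
  forall eps : posreal,
    locally p (fun q => forall t, a <= t <= b -> Rabs (F q t - F p t) < eps).
Proof.
  intros HF eps.
  assert (HE : forall t, exists d : posreal, a <= t <= b ->
    forall q t', ball p d q -> ball t d t' ->
      Rabs (F q t' - F p t) < pos_div_2 eps).
  { intros t. destruct (excluded_middle_informative (a <= t <= b)) as [Ht|Ht].
    - destruct (proj1 (filterlim_locally _ _) (HF t Ht) (pos_div_2 eps))
        as [d Hd].
      exists d. intros _ q t' Hq Ht'.
      exact (Hd (q, t') (conj Hq Ht')).
    (* The gauge must be defined on all of [R]; outside [[a, b]] its value is arbitrary. *)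
    - exists (mkposreal 1 Rlt_0_1). tauto. }
  set (delta := fun t => proj1_sig (constructive_indefinite_description _ (HE t))).
  destruct (compactness_value_1d a b delta) as [d Hd].
  exists d. intros q Hq t Ht.
  (* The compactness statement yields the nearby point [s] under a double negation, so the bound is
     proved by refuting its negation. Both values are then within [eps / 2] of [F p s]. *)
  apply Rnot_le_lt. intros Hle. apply (Hd t Ht). intros [s [Hs [Hst Hds]]].
  assert (Hp := proj2_sig (constructive_indefinite_description _ (HE s)) Hs).
  fold (delta s) in Hp. cbv beta in Hp.
  assert (Hb : ball s (delta s) t) by exact Hst.
  assert (H1 := Hp q t (ball_le _ _ _ Hds _ Hq) Hb).
  assert (H2 := Hp p t (ball_center _ _) Hb).
  change (pos (pos_div_2 eps)) with (eps / 2) in H1, H2.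
  revert H1 H2 Hle. unfold Rabs. repeat destruct Rcase_abs; lra.
Qed.

Lemma ex_RInt_cont (f : R -> R) (a b : R) :
  (forall t, continuous f t) -> ex_RInt f a b.
Proof.
  intros H. apply (ex_RInt_continuous (V := R_CompleteNormedModule)).
  intros; apply H.
Qed.

Lemma RInt_Rplus (f g : R -> R) (a b : R) :
  ex_RInt f a b -> ex_RInt g a b ->
  RInt (fun t => f t + g t) a b = RInt f a b + RInt g a b.
Proof. exact (RInt_plus (V := R_CompleteNormedModule) f g a b). Qed.

Lemma RInt_Rminus (f g : R -> R) (a b : R) :
  ex_RInt f a b -> ex_RInt g a b ->
  RInt (fun t => f t - g t) a b = RInt f a b - RInt g a b.
Proof. exact (RInt_minus (V := R_CompleteNormedModule) f g a b). Qed.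

Lemma RInt_Rmult (k : R) (f : R -> R) (a b : R) :
  ex_RInt f a b -> RInt (fun t => k * f t) a b = k * RInt f a b.
Proof. exact (RInt_scal (V := R_CompleteNormedModule) f a b k). Qed.

Lemma ex_RInt_Rplus (f g : R -> R) (a b : R) :
  ex_RInt f a b -> ex_RInt g a b -> ex_RInt (fun t => f t + g t) a b.
Proof. exact (ex_RInt_plus (V := R_NormedModule) f g a b). Qed.

Lemma ex_RInt_Rminus (f g : R -> R) (a b : R) :
  ex_RInt f a b -> ex_RInt g a b -> ex_RInt (fun t => f t - g t) a b.
Proof. exact (ex_RInt_minus (V := R_NormedModule) f g a b). Qed.

Lemma ex_RInt_Rmult (k : R) (f : R -> R) (a b : R) :
  ex_RInt f a b -> ex_RInt (fun t => k * f t) a b.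
Proof. exact (ex_RInt_scal (V := R_NormedModule) f a b k). Qed.

Lemma RInt_Rext (f g : R -> R) (a b : R) :
  a <= b -> (forall t, a < t < b -> f t = g t) -> RInt f a b = RInt g a b.
Proof.
  intros Hab H. apply (RInt_ext (V := R_CompleteNormedModule)).
  now rewrite Rmin_left, Rmax_right by exact Hab.
Qed.

Lemma RInt_Rconst (a b c : R) : RInt (fun _ => c) a b = (b - a) * c.
Proof. exact (RInt_const (V := R_CompleteNormedModule) a b c). Qed.

Lemma RInt_close (f g : R -> R) (a b e : R) :
  a <= b -> ex_RInt f a b -> ex_RInt g a b ->
  (forall t, a <= t <= b -> Rabs (f t - g t) <= e) ->
  Rabs (RInt f a b - RInt g a b) <= (b - a) * e.
Proof.
  intros Hab Hf Hg H.
  rewrite <- RInt_Rminus by assumption.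
  apply abs_RInt_le_const; [exact Hab| |exact H].
  now apply ex_RInt_Rminus.
Qed.

Lemma continuous_RInt_param_loc {T : UniformSpace} (F : T -> R -> R) (a b : R) (p : T) :
  a <= b ->
  locally p (fun q => ex_RInt (F q) a b) ->
  (forall t, a <= t <= b ->
     continuous (fun q : T * R => F (fst q) (snd q)) (p, t)) ->
  continuous (fun q => RInt (F q) a b) p.
Proof.
  intros Hab Hex HF. apply filterlim_locally. intros eps.
  (* The added 1 covers the case [a = b]. *)
  assert (He : 0 < eps / (b - a + 1)).
  { apply Rdiv_lt_0_compat; [apply cond_pos | lra]. }
  assert (Hp := locally_singleton _ _ Hex).
  generalize (filter_and _ _ Hex (tube F a b p HF (mkposreal _ He))).
  apply filter_imp. intros q [Hq Ht].
  change (Rabs (RInt (F q) a b - RInt (F p) a b) < eps).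
  eapply Rle_lt_trans.
  { apply (RInt_close (F q) (F p) a b (eps / (b - a + 1))); auto.
    intros t Ht'. left. now apply Ht. }
  assert (eps / (b - a + 1) * (b - a + 1) = eps) by (field; lra).
  simpl in He. nra.
Qed.

Lemma continuous_RInt_param {T : UniformSpace} (F : T -> R -> R) (a b : R) :
  (forall q : T * R, continuous (fun q : T * R => F (fst q) (snd q)) q) ->
  forall p, continuous (fun q => RInt (F q) a b) p.
Proof.
  intros HF p.
  assert (Hex : forall q a b, ex_RInt (F q) a b).
  { intros q a' b'. apply ex_RInt_cont. intros t.
    apply (continuous_comp (fun t => (q, t)) (fun q => F (fst q) (snd q)));
      [cont | apply HF]. }
  destruct (Rle_dec a b) as [Hab|Hab].
  - apply continuous_RInt_param_loc; auto. now apply filter_forall.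
  - apply (continuous_ext (fun q => - RInt (F q) b a)).
    + intros q. apply (opp_RInt_swap (V := R_CompleteNormedModule)), Hex.
    + apply continuous_Ropp, continuous_RInt_param_loc; [lra| |auto].
      now apply filter_forall.
Qed.

Lemma FTC (f f' : R -> R) (a b : R) :
  (forall x, is_derive f x (f' x)) -> (forall x, continuous f' x) ->
  RInt f' a b = f b - f a.
Proof.
  intros Hf Hf'. apply is_RInt_unique.
  apply (is_RInt_derive (V := R_CompleteNormedModule)); auto.
Qed.

(** The mean value theorem writes each increment as [F' c t * (y - x)] with [c] between [x] and [y],
    and [tube] brings [F' c t] close to [F' x t] uniformly in [t]. The hypotheses are local in [x]
    because the Poisson kernel is smooth only inside the disc. *)
Lemma is_derive_RInt_param_cont (F F' : R -> R -> R) (a b x : R) :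
  a <= b ->
  locally x (fun y => forall t, a <= t <= b ->
    is_derive (fun z => F z t) y (F' y t)) ->
  locally x (fun y => ex_RInt (F y) a b) ->
  (forall t, a <= t <= b -> continuous (F' x) t) ->
  (forall t, a <= t <= b ->
     continuous (fun q : R * R => F' (fst q) (snd q)) (x, t)) ->
  is_derive (fun y => RInt (F y) a b) x (RInt (F' x) a b).
Proof.
  intros Hab HD Hex HF'x HF'. split; [apply is_linear_scal_l|].
  intros x0 Hx0 eps.
  apply (is_filter_lim_locally_unique (V := R_NormedModule)) in Hx0. subst x0.
  assert (He : 0 < eps / (b - a + 1)).
  { apply Rdiv_lt_0_compat; [apply cond_pos | lra]. }
  assert (Hp := locally_singleton _ _ Hex).
  assert (HexF' : ex_RInt (F' x) a b).
  { apply (ex_RInt_continuous (V := R_CompleteNormedModule)).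
    rewrite Rmin_left, Rmax_right by lra. auto. }
  assert (HT := filter_and _ _ HD (tube F' a b x HF' (mkposreal _ He))).
  destruct (filter_and _ _ Hex HT) as [d Hd].
  exists d. intros y Hy.
  destruct (Hd y Hy) as [Hexy _].
  change (Rabs (RInt (F y) a b - RInt (F x) a b - (y - x) * RInt (F' x) a b)
          <= eps * Rabs (y - x)).
  rewrite <- (RInt_Rmult (y - x) (F' x)), <- RInt_Rminus by assumption.
  eapply Rle_trans.
  { apply (RInt_close _ _ a b (eps / (b - a + 1) * Rabs (y - x))); auto.
    - now apply ex_RInt_Rminus.
    - now apply ex_RInt_Rmult.
    - intros t Ht.
      destruct (MVT_gen (fun z => F z t) x y (fun z => F' z t)) as [c [Hc Ec]].
      + intros z Hz.
        apply (Hd z); [|exact Ht].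
        change (Rabs (z - x) < d). change (Rabs (y - x) < d) in Hy.
        revert Hz Hy. unfold Rmin, Rmax, Rabs.
        destruct Rle_dec; repeat destruct Rcase_abs; lra.
      + intros z Hz. apply continuity_pt_filterlim.
        apply (ex_derive_continuous (V := R_NormedModule) (fun z => F z t)).
        exists (F' z t). apply (Hd z); [|exact Ht].
        change (Rabs (z - x) < d). change (Rabs (y - x) < d) in Hy.
        revert Hz Hy. unfold Rmin, Rmax, Rabs.
        destruct Rle_dec; repeat destruct Rcase_abs; lra.
      + rewrite Ec.
        replace (F' c t * (y - x) - (y - x) * F' x t)
          with ((F' c t - F' x t) * (y - x)) by ring.
        rewrite Rabs_mult. apply Rmult_le_compat_r; [apply Rabs_pos|].
        left. apply (Hd c); [|exact Ht].
        change (Rabs (c - x) < d). change (Rabs (y - x) < d) in Hy.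
        revert Hc Hy. unfold Rmin, Rmax, Rabs.
        destruct Rle_dec; repeat destruct Rcase_abs; lra. }
  rewrite <- Rmult_assoc. apply Rmult_le_compat_r; [apply Rabs_pos|].
  assert (eps / (b - a + 1) * (b - a + 1) = eps) by (field; lra).
  simpl in He. nra.
Qed.

(** * Circle integrals and the potential in polar coordinates *)

(** The angular weight [k] is [one] for means, and [cos] or [sin] for pairing with a component of
    the unit normal. *)
Definition circ (g : R -> R -> R) (k : R -> R) (x y s : R) : R :=
  RInt (fun t => g (x + s * cos t) (y + s * sin t) * k t) 0 (2 * PI).

(* The Jacobian of polar coordinates cancels the singularity of the kernel.
   From any point of the unit disc, the circle of radius 6 lies outside the
   square [|x|, |y| < 3] that will support every [g] used here. *)
Definition pot (g : R -> R -> R) (k : R -> R) (x y : R) : R :=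
  RInt (fun s => circ g k x y s) 0 6.

Definition one (t : R) : R := 1.

Lemma cont_one : forall t, continuous one t.
Proof. intros t. apply continuous_const. Qed.

Lemma two_PI_pos : 0 <= 2 * PI.
Proof. assert (H := PI_RGT_0). lra. Qed.

Lemma ex_circ (g : R -> R -> R) (k : R -> R) (x y s : R) :
  cont2 g -> (forall t, continuous k t) ->
  ex_RInt (fun t => g (x + s * cos t) (y + s * sin t) * k t) 0 (2 * PI).
Proof. intros Hg Hk. apply ex_RInt_cont. intros t. cont. Qed.

Lemma jcont_at {T U : UniformSpace} (G : U -> R -> R -> R)
  (A : T -> U) (X Y : T -> R) (p : T) :
  jcont G -> continuous A p -> continuous X p -> continuous Y p ->
  continuous (fun q => G (A q) (X q) (Y q)) p.
Proof.
  intros HG HA HX HY.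
  apply (continuous_comp (fun q => ((A q, X q), Y q))
    (fun q : (U * R) * R => G (fst (fst q)) (snd (fst q)) (snd q))); [cont | apply HG].
Qed.

Lemma jcont_cont2 {T : UniformSpace} (G : T -> R -> R -> R) (p : T) :
  jcont G -> cont2 (G p).
Proof.
  intros HG q. apply (jcont_at G (fun _ => p) (fun q => fst q) (fun q => snd q)); try exact HG; cont.
Qed.

Lemma cont2_jcont {T : UniformSpace} (g : R -> R -> R) :
  cont2 g -> jcont (fun _ : T => g).
Proof. intros Hg q. cont. Qed.

Lemma jcont_circ {T : UniformSpace} (G : T -> R -> R -> R) (k : R -> R) (X Y S : T -> R) (p : T) :
  jcont G -> (forall t, continuous k t) ->
  continuous X p -> continuous Y p -> continuous S p ->
  continuous (fun q => circ (G q) k (X q) (Y q) (S q)) p.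
Proof.
  intros HG Hk HX HY HS. unfold circ.
  apply (continuous_RInt_param_loc
    (fun q t => G q (X q + S q * cos t) (Y q + S q * sin t) * k t)).
  - apply two_PI_pos.
  - apply filter_forall. intros q. apply ex_circ; [now apply jcont_cont2 | assumption].
  - intros t _.
    assert (H1 : forall h : T -> R, continuous h p ->
       continuous (fun q : T * R => h (fst q)) (p, t)).
    { intros h Hh. apply (continuous_comp fst h); [apply continuous_fst | exact Hh]. }
    assert (H2 : continuous (fun q : T * R => snd q) (p, t)) by apply continuous_snd.
    assert (HX' := H1 _ HX). assert (HY' := H1 _ HY). assert (HS' := H1 _ HS).
    apply continuous_Rmult; [|cont].
    apply (jcont_at G (fun q : T * R => fst q) (fun q => X (fst q) + S (fst q) * cos (snd q))
      (fun q => Y (fst q) + S (fst q) * sin (snd q))); cont.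
Qed.

Lemma cont_circ {T : UniformSpace} (g : R -> R -> R) (k : R -> R) (X Y S : T -> R) (p : T) :
  cont2 g -> (forall t, continuous k t) ->
  continuous X p -> continuous Y p -> continuous S p ->
  continuous (fun q => circ g k (X q) (Y q) (S q)) p.
Proof.
  intros Hg. apply (jcont_circ (fun _ : T => g)). now apply cont2_jcont.
Qed.

Lemma ex_pot (g : R -> R -> R) (k : R -> R) (x y a b : R) :
  cont2 g -> (forall t, continuous k t) -> ex_RInt (fun s => circ g k x y s) a b.
Proof.
  intros Hg Hk. apply ex_RInt_cont. intros s.
  apply (cont_circ g k (fun _ => x) (fun _ => y) (fun s => s)); cont.
Qed.

Lemma jcont_pot {T : UniformSpace} (G : T -> R -> R -> R) (k : R -> R) :
  jcont G -> (forall t, continuous k t) -> jcont (fun q => pot (G q) k).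
Proof.
  intros HG Hk p. unfold pot.
  apply (continuous_RInt_param
    (fun (q : (T * R) * R) s => circ (G (fst (fst q))) k (snd (fst q)) (snd q) s)).
  - intros q.
    apply (jcont_circ (fun q : ((T * R) * R) * R => G (fst (fst (fst q)))) k
      (fun q => snd (fst (fst q))) (fun q => snd (fst q)) (fun q => snd q)); try cont.
    intros r. apply (jcont_at G (fun q => fst (fst (fst (fst (fst q)))))
      (fun q => snd (fst q)) (fun q => snd q)); try exact HG; cont.
Qed.

Lemma cont2_pot (g : R -> R -> R) (k : R -> R) :
  cont2 g -> (forall t, continuous k t) -> cont2 (pot g k).
Proof.
  intros Hg Hk. apply (jcont_cont2 (fun _ : R_UniformSpace => pot g k) 0).
  apply (jcont_pot (fun _ : R_UniformSpace => g)); [now apply cont2_jcont | exact Hk].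
Qed.

(** * Divergence and curl of the potential of a smooth density *)

Definition C1 (g gx gy : R -> R -> R) : Prop :=
  cont2 g /\ cont2 gx /\ cont2 gy /\
  (forall x y, is_derive (fun x => g x y) x (gx x y)) /\
  (forall x y, is_derive (fun y => g x y) y (gy x y)).

Lemma C1_chain (g gx gy : R -> R -> R) (X Y : R -> R) (s X' Y' : R) :
  C1 g gx gy -> is_derive X s X' -> is_derive Y s Y' ->
  is_derive (fun s => g (X s) (Y s)) s (gx (X s) (Y s) * X' + gy (X s) (Y s) * Y').
Proof.
  intros (Hg & Hgx & Hgy & Dx & Dy) HX HY.
  assert (HF : filterdiff (fun u : R * R => g (fst u) (snd u)) (locally (X s, Y s))
    (fun u : R * R => plus (scal (fst u) (gx (X s) (Y s))) (scal (snd u) (gy (X s) (Y s))))).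
  { apply is_derive_filterdiff.
    - apply filter_forall. intros [u v]. apply Dx.
    - apply Dy.
    - apply Hgx. }
  eapply filterdiff_ext_lin.
  { apply (filterdiff_comp'_2 X Y g s _ _
      (fun a b => plus (scal a (gx (X s) (Y s))) (scal b (gy (X s) (Y s)))) HX HY HF). }
  intros y. simpl. unfold scal, plus. simpl. unfold mult. simpl. ring.
Qed.

Lemma C1_radial (g gx gy : R -> R -> R) (x y s t : R) :
  C1 g gx gy ->
  is_derive (fun s => g (x + s * cos t) (y + s * sin t)) s
    (gx (x + s * cos t) (y + s * sin t) * cos t
     + gy (x + s * cos t) (y + s * sin t) * sin t).
Proof.
  intros H. apply (C1_chain g gx gy (fun s => x + s * cos t) (fun s => y + s * sin t) s);
    [exact H | |]; (auto_derive; [exact I | ring]).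
Qed.

Lemma C1_angular (g gx gy : R -> R -> R) (x y s t : R) :
  C1 g gx gy ->
  is_derive (fun t => g (x + s * cos t) (y + s * sin t)) t
    (s * (gy (x + s * cos t) (y + s * sin t) * cos t
     - gx (x + s * cos t) (y + s * sin t) * sin t)).
Proof.
  intros H.
  replace (s * _) with (gx (x + s * cos t) (y + s * sin t) * (- s * sin t)
     + gy (x + s * cos t) (y + s * sin t) * (s * cos t)) by ring.
  apply (C1_chain g gx gy (fun t => x + s * cos t) (fun t => y + s * sin t) t);
    [exact H | |]; (auto_derive; [exact I | ring]).
Qed.

Lemma is_derive_Rmult_const (f : R -> R) (x l k : R) :
  is_derive f x l -> is_derive (fun z => f z * k) x (l * k).
Proof.
  intros H. rewrite Rmult_comm.
  apply (is_derive_ext (fun z => k * f z)); [intros z; apply Rmult_comm|].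
  now apply is_derive_scal.
Qed.

(** In polar coordinates centred at the point, moving the point only translates [g], so the
    derivatives fall on the density and no singular kernel is differentiated. *)
Lemma pot_C1 (g gx gy : R -> R -> R) (k : R -> R) :
  C1 g gx gy -> (forall t, continuous k t) ->
  C1 (pot g k) (pot gx k) (pot gy k).
Proof.
  intros (Hg & Hgx & Hgy & Dx & Dy) Hk.
  split; [|split; [|split; [|split]]]; try now apply cont2_pot.
  - intros x y. unfold pot.
    apply (is_derive_RInt_param_cont (fun x s => circ g k x y s) (fun x s => circ gx k x y s)).
    + lra.
    + apply filter_forall. intros x' s _. unfold circ.
      apply (is_derive_RInt_param_cont
        (fun x t => g (x + s * cos t) (y + s * sin t) * k t)
        (fun x t => gx (x + s * cos t) (y + s * sin t) * k t)).
      * apply two_PI_pos.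
      * apply filter_forall. intros x'' t _. apply is_derive_Rmult_const.
        replace (gx _ _) with (scal 1 (gx (x'' + s * cos t) (y + s * sin t)))
          by (unfold scal; simpl; unfold mult; simpl; ring).
        apply (is_derive_comp (fun x => g x (y + s * sin t)) (fun x => x + s * cos t)).
        -- apply Dx.
        -- auto_derive; auto.
      * apply filter_forall. intros q. now apply ex_circ.
      * intros t _. cont.
      * intros t _. cont.
    + apply filter_forall. intros q. now apply ex_pot.
    + intros s _. apply (cont_circ gx k (fun _ => x) (fun _ => y) (fun s => s)); cont.
    + intros s _. apply (cont_circ gx k (fun q : R * R => fst q) (fun _ => y) (fun q : R * R => snd q)); cont.
  - intros x y. unfold pot.
    apply (is_derive_RInt_param_cont (fun y s => circ g k x y s) (fun y s => circ gy k x y s)).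
    + lra.
    + apply filter_forall. intros y' s _. unfold circ.
      apply (is_derive_RInt_param_cont
        (fun y t => g (x + s * cos t) (y + s * sin t) * k t)
        (fun y t => gy (x + s * cos t) (y + s * sin t) * k t)).
      * apply two_PI_pos.
      * apply filter_forall. intros y'' t _. apply is_derive_Rmult_const.
        replace (gy _ _) with (scal 1 (gy (x + s * cos t) (y'' + s * sin t)))
          by (unfold scal; simpl; unfold mult; simpl; ring).
        apply (is_derive_comp (fun y => g (x + s * cos t) y) (fun y => y + s * sin t)).
        -- apply Dy.
        -- auto_derive; auto.
      * apply filter_forall. intros q. now apply ex_circ.
      * intros t _. cont.
      * intros t _. cont.
    + apply filter_forall. intros q. now apply ex_pot.
    + intros s _. apply (cont_circ gy k (fun _ => x) (fun _ => y) (fun s => s)); cont.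
    + intros s _. apply (cont_circ gy k (fun _ => x) (fun q : R * R => fst q) (fun q : R * R => snd q)); cont.
Qed.

Lemma circ_0 (g : R -> R -> R) (x y : R) : circ g one x y 0 = 2 * PI * g x y.
Proof.
  unfold circ, one.
  rewrite (RInt_Rext _ (fun _ => g x y)).
  - rewrite RInt_Rconst. ring.
  - apply two_PI_pos.
  - intros t _. rewrite !Rmult_0_l, !Rplus_0_r. ring.
Qed.

Lemma circ_ext (g h : R -> R -> R) (k : R -> R) (x y s : R) :
  (forall t, g (x + s * cos t) (y + s * sin t) = h (x + s * cos t) (y + s * sin t)) ->
  circ g k x y s = circ h k x y s.
Proof. intros H. apply RInt_Rext; [apply two_PI_pos|].
  intros t _. now rewrite H. Qed.

(** The angular derivative of [g] integrates to zero over a full turn; the factor [s] is then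
    cancelled. *)
Lemma C1_tangential (g gx gy : R -> R -> R) (x y s : R) :
  C1 g gx gy -> s <> 0 -> circ gx sin x y s = circ gy cos x y s.
Proof.
  intros H Hs. assert (H' := H). destruct H' as (Hg & Hgx & Hgy & _ & _).
  assert (E := FTC (fun t => g (x + s * cos t) (y + s * sin t)) _ 0 (2 * PI)
    (fun t => C1_angular g gx gy x y s t H) ltac:(intros; cont)).
  cbv beta in E.
  rewrite cos_2PI, sin_2PI, cos_0, sin_0, Rminus_diag in E.
  rewrite (RInt_Rmult s (fun t => gy (x + s * cos t) (y + s * sin t) * cos t -
     gx (x + s * cos t) (y + s * sin t) * sin t)) in E
    by (apply ex_RInt_cont; intros; cont).
  apply Rmult_integral in E. destruct E as [E|E]; [easy|].
  rewrite (RInt_Rminus (fun t => gy (x + s * cos t) (y + s * sin t) * cos t)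
     (fun t => gx (x + s * cos t) (y + s * sin t) * sin t)) in E
    by (apply ex_RInt_cont; intros; cont).
  unfold circ. lra.
Qed.

Lemma circ_derive (g gx gy : R -> R -> R) (k : R -> R) (x y s : R) :
  C1 g gx gy -> (forall t, continuous k t) ->
  is_derive (fun s => circ g k x y s) s
    (RInt (fun t => (gx (x + s * cos t) (y + s * sin t) * cos t
      + gy (x + s * cos t) (y + s * sin t) * sin t) * k t) 0 (2 * PI)).
Proof.
  intros H Hk. assert (H' := H). destruct H' as (Hg & Hgx & Hgy & _ & _).
  unfold circ. apply (is_derive_RInt_param_cont
      (fun s t => g (x + s * cos t) (y + s * sin t) * k t)
      (fun s t => (gx (x + s * cos t) (y + s * sin t) * cos t
        + gy (x + s * cos t) (y + s * sin t) * sin t) * k t)).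
  - apply two_PI_pos.
  - apply filter_forall. intros s' t _. apply is_derive_Rmult_const.
    now apply C1_radial.
  - apply filter_forall. intros q. now apply ex_circ.
  - intros t _. cont.
  - intros t _. cont.
Qed.

(** The integrand is the derivative in [s] of [circ g one x y s], whose value at radius 0 is
    [circ_0]. *)
Lemma C1_radial_int (g gx gy : R -> R -> R) (x y r : R) :
  C1 g gx gy ->
  RInt (fun s => circ gx cos x y s + circ gy sin x y s) 0 r
  = circ g one x y r - 2 * PI * g x y.
Proof.
  intros H. assert (H' := H). destruct H' as (Hg & Hgx & Hgy & _ & _).
  rewrite <- circ_0. apply (FTC (fun s => circ g one x y s)).
  - intros s. eapply (eq_rect _ (fun l => is_derive _ s l)).
    { apply (circ_derive g gx gy); [assumption | apply cont_one]. }
    unfold circ.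
    rewrite <- (RInt_Rplus (fun t => gx (x + s * cos t) (y + s * sin t) * cos t)
      (fun t => gy (x + s * cos t) (y + s * sin t) * sin t))
      by (apply ex_RInt_cont; intros; cont).
    apply RInt_Rext; [apply two_PI_pos|]. intros t _. unfold one. ring.
  - intros s. apply continuous_Rplus.
    + apply (cont_circ gx cos (fun _ => x) (fun _ => y) (fun s => s)); cont.
    + apply (cont_circ gy sin (fun _ => x) (fun _ => y) (fun s => s)); cont.
Qed.

Lemma circ_scal (k : R -> R) (g : R -> R -> R) (x y s c : R) :
  cont2 g -> (forall t, continuous k t) ->
  circ (fun x y => c * g x y) k x y s = c * circ g k x y s.
Proof.
  intros Hg Hk. unfold circ.
  rewrite <- (RInt_Rmult c) by now apply ex_circ.
  apply RInt_Rext; [apply two_PI_pos|]. intros t _. ring.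
Qed.

Lemma circ_plus (k : R -> R) (g h : R -> R -> R) (x y s : R) :
  cont2 g -> cont2 h -> (forall t, continuous k t) ->
  circ (fun x y => g x y + h x y) k x y s = circ g k x y s + circ h k x y s.
Proof.
  intros Hg Hh Hk. unfold circ.
  rewrite <- RInt_Rplus by now apply ex_circ.
  apply RInt_Rext; [apply two_PI_pos|]. intros t _. ring.
Qed.

Lemma cont2_plus (g h : R -> R -> R) :
  cont2 g -> cont2 h -> cont2 (fun x y => g x y + h x y).
Proof. intros Hg Hh p. apply continuous_Rplus; [apply Hg | apply Hh]. Qed.

Lemma cont2_scal (c : R) (g : R -> R -> R) :
  cont2 g -> cont2 (fun x y => c * g x y).
Proof. intros Hg p. apply continuous_Rmult; [apply continuous_const | apply Hg]. Qed.

Lemma cont2_minus (g h : R -> R -> R) :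
  cont2 g -> cont2 h -> cont2 (fun x y => g x y - h x y).
Proof. intros Hg Hh p. apply continuous_Rminus; [apply Hg | apply Hh]. Qed.

(** Integrating the radial derivative outwards leaves only the centre, since [g] vanishes on the
    circle of radius 6. This is Poisson's equation: the divergence of the field is [- 2 PI g]. *)
Lemma pot_div (g gx gy : R -> R -> R) (x y : R) :
  C1 g gx gy -> (forall t, g (x + 6 * cos t) (y + 6 * sin t) = 0) ->
  pot gx cos x y + pot gy sin x y = - 2 * PI * g x y.
Proof.
  intros H H0. unfold pot.
  assert (H' := H). destruct H' as (Hg & Hgx & Hgy & _ & _).
  rewrite <- RInt_Rplus by (apply ex_pot; cont).
  rewrite (C1_radial_int g) by assumption.
  unfold circ. rewrite (RInt_Rext _ (fun _ => 0)).
  - rewrite RInt_Rconst. ring.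
  - apply two_PI_pos.
  - intros t _. rewrite H0. ring.
Qed.

(** The curl already vanishes circle by circle, through [C1_tangential]. *)
Lemma pot_curl (g gx gy : R -> R -> R) (x y : R) :
  C1 g gx gy -> pot gx sin x y = pot gy cos x y.
Proof.
  intros H. apply RInt_Rext; [lra|]. intros s Hs.
  apply (C1_tangential g); [assumption | lra].
Qed.

(** For a curl-free field the Laplacian of each component is a partial derivative of the divergence.
    Second derivatives are avoided: in the radial formula for [V1], the term with [V1y = V2x] is
    exchanged for one with [V2y] by the tangential identity, and symmetrically for [V2]. *)
Lemma curl_free_mean (V1 V1x V1y V2 V2x V2y : R -> R -> R) (x y r : R) :
  C1 V1 V1x V1y -> C1 V2 V2x V2y -> (forall x y, V2x x y = V1y x y) -> 0 <= r ->
  circ V1 one x y r - 2 * PI * V1 x y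
    = RInt (fun s => circ (fun x y => V1x x y + V2y x y) cos x y s) 0 r /\
  circ V2 one x y r - 2 * PI * V2 x y
    = RInt (fun s => circ (fun x y => V1x x y + V2y x y) sin x y s) 0 r.
Proof.
  intros H1 H2 Hc Hr.
  assert (H1' := H1). destruct H1' as (_ & C1x & C1y & _ & _).
  assert (H2' := H2). destruct H2' as (_ & C2x & C2y & _ & _).
  rewrite <- (C1_radial_int V1 V1x V1y), <- (C1_radial_int V2 V2x V2y) by assumption.
  split; apply RInt_Rext; try assumption; intros s Hs; rewrite circ_plus by cont;
    assert (E1 := C1_tangential V1 _ _ x y s H1 ltac:(lra));
    assert (E2 := C1_tangential V2 _ _ x y s H2 ltac:(lra)).
  - rewrite <- E2, (circ_ext V2x V1y sin) by auto. reflexivity.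
  - rewrite E1, (circ_ext V2x V1y cos) by auto. reflexivity.
Qed.

(** The divergence theorem on a disc, obtained by differentiating both sides in the radius; both
    vanish at radius 0. *)
Lemma disc_divergence (V1 V1x V1y V2 V2x V2y : R -> R -> R) (x y r : R) :
  C1 V1 V1x V1y -> C1 V2 V2x V2y ->
  r * (circ V1 cos x y r + circ V2 sin x y r)
    = RInt (fun s => s * circ (fun x y => V1x x y + V2y x y) one x y s) 0 r.
Proof.
  intros H1 H2.
  assert (H1' := H1). destruct H1' as (C1 & C1x & C1y & _ & _).
  assert (H2' := H2). destruct H2' as (C2 & C2x & C2y & _ & _).
  assert (Cone := cont_one).
  rewrite (FTC (fun r => r * (circ V1 cos x y r + circ V2 sin x y r))); [ring| |].
  2: { intros s. apply continuous_Rmult; [cont|].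
       apply (cont_circ (fun x y => V1x x y + V2y x y) one (fun _ => x) (fun _ => y) (fun s => s));
         try cont. now apply cont2_plus. }
  intros s.
  (* The tangential component of the field is periodic in [t], so its angular derivative has zero
     integral. This removes the terms by which the derivative of the flux differs from the
     divergence. *)
  assert (DA : forall t, is_derive (fun t =>
     V1 (x + s * cos t) (y + s * sin t) * sin t - V2 (x + s * cos t) (y + s * sin t) * cos t) t
     ((V1 (x + s * cos t) (y + s * sin t) * cos t + V2 (x + s * cos t) (y + s * sin t) * sin t)
      + s * (V1y (x + s * cos t) (y + s * sin t) * cos t * sin t
         - V1x (x + s * cos t) (y + s * sin t) * sin t * sin t
         - V2y (x + s * cos t) (y + s * sin t) * cos t * cos t
         + V2x (x + s * cos t) (y + s * sin t) * sin t * cos t))).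
  { intros t.
    assert (D1 := C1_angular V1 _ _ x y s t H1).
    assert (D2 := C1_angular V2 _ _ x y s t H2).
    apply (is_derive_ext (fun t => minus (mult (V1 (x + s * cos t) (y + s * sin t)) (sin t))
       (mult (V2 (x + s * cos t) (y + s * sin t)) (cos t)))); [reflexivity|].
    eapply (eq_rect _ (fun l => is_derive _ t l)).
    - apply (is_derive_minus (V := R_NormedModule)).
      + apply (is_derive_mult (K := R_AbsRing)); [exact D1 | apply is_derive_sin | intros; apply Rmult_comm].
      + apply (is_derive_mult (K := R_AbsRing)); [exact D2 | apply is_derive_cos | intros; apply Rmult_comm].
    - unfold minus, plus, opp, mult. simpl. ring. }
  assert (E := FTC _ _ 0 (2 * PI) DA ltac:(intros; cont)). cbv beta in E.
  rewrite cos_2PI, sin_2PI, cos_0, sin_0, !Rmult_0_r, Rminus_diag in E.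
  pose (P1 := fun t => V1x (x + s * cos t) (y + s * sin t)).
  pose (Q1 := fun t => V1y (x + s * cos t) (y + s * sin t)).
  pose (P2 := fun t => V2x (x + s * cos t) (y + s * sin t)).
  pose (Q2 := fun t => V2y (x + s * cos t) (y + s * sin t)).
  assert (DP : is_derive (fun r => circ V1 cos x y r + circ V2 sin x y r) s
     (RInt (fun t => (P1 t * cos t + Q1 t * sin t) * cos t) 0 (2 * PI)
      + RInt (fun t => (P2 t * cos t + Q2 t * sin t) * sin t) 0 (2 * PI))).
  { apply (is_derive_plus (V := R_NormedModule)).
    - now apply circ_derive, continuous_cos.
    - now apply circ_derive, continuous_sin. }
  eapply (eq_rect _ (fun l => is_derive _ s l)).
  { apply (is_derive_mult (K := R_AbsRing) (fun r => r)
      (fun r => circ V1 cos x y r + circ V2 sin x y r) s 1 _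
      (is_derive_id (K := R_AbsRing) s) DP Rmult_comm). }
  unfold plus, mult. simpl.
  assert (CP1 : forall t, continuous P1 t) by (intros t; unfold P1; cont).
  assert (CQ1 : forall t, continuous Q1 t) by (intros t; unfold Q1; cont).
  assert (CP2 : forall t, continuous P2 t) by (intros t; unfold P2; cont).
  assert (CQ2 : forall t, continuous Q2 t) by (intros t; unfold Q2; cont).
  rewrite RInt_Rplus, RInt_Rmult in E by (apply ex_RInt_cont; intros; cont).
  rewrite RInt_Rplus in E by (apply ex_RInt_cont; intros; cont).
  fold (circ V1 cos x y s) (circ V2 sin x y s) in E.
  replace (circ (fun x y => V1x x y + V2y x y) one x y s) with
    (RInt (fun t => (P1 t * cos t + Q1 t * sin t) * cos t) 0 (2 * PI)
      + RInt (fun t => (P2 t * cos t + Q2 t * sin t) * sin t) 0 (2 * PI)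
      - RInt (fun t => Q1 t * cos t * sin t - P1 t * sin t * sin t
          - Q2 t * cos t * cos t + P2 t * sin t * cos t) 0 (2 * PI)).
  - unfold P1, Q1, P2, Q2 in *. lra.
  - rewrite <- RInt_Rplus by (apply ex_RInt_cont; intros; cont).
    rewrite <- RInt_Rminus by (apply ex_RInt_cont; intros; cont).
    apply RInt_Rext; [apply two_PI_pos|]. intros t _.
    fold (P1 t) (Q2 t). unfold one.
    assert (Hcs := sin2_cos2 t). unfold Rsqr in Hcs.
    transitivity (P1 t * (cos t * cos t + sin t * sin t)
      + Q2 t * (cos t * cos t + sin t * sin t)); [ring|].
    rewrite Rplus_comm in Hcs. rewrite Hcs. ring.
Qed.

(** * Mean, flux and circulation of the potential *)

Definition box_supp (b : R) (g : R -> R -> R) : Prop :=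
  forall x y, b <= Rabs x \/ b <= Rabs y -> g x y = 0.

(** Otherwise [6 cos t] and [6 sin t] would both be below 4 in absolute value, and 36 would be less
    than 32. *)
Lemma box_supp_far (g : R -> R -> R) (x y t : R) :
  box_supp 3 g -> Rabs x <= 1 -> Rabs y <= 1 ->
  g (x + 6 * cos t) (y + 6 * sin t) = 0.
Proof.
  intros Hg Hx Hy. apply Hg.
  destruct (Rle_dec 3 (Rabs (x + 6 * cos t))) as [H|H]; [now left | right].
  apply Rnot_le_lt in H. apply Rnot_lt_le. intros H'.
  apply Rabs_le_between in Hx, Hy.
  apply Rabs_lt_between in H, H'.
  assert (Hcs := sin2_cos2 t). unfold Rsqr in Hcs. nra.
Qed.

(** In order: the means of the two components, the flux, and the circulation of the field. No
    derivative occurs, so the law makes sense for a continuous density. *)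
Definition pot_law (g : R -> R -> R) (x y r : R) : Prop :=
  circ (pot g cos) one x y r - 2 * PI * pot g cos x y
    = - 2 * PI * RInt (fun s => circ g cos x y s) 0 r /\
  circ (pot g sin) one x y r - 2 * PI * pot g sin x y
    = - 2 * PI * RInt (fun s => circ g sin x y s) 0 r /\
  r * (circ (pot g cos) cos x y r + circ (pot g sin) sin x y r)
    = - 2 * PI * RInt (fun s => s * circ g one x y s) 0 r /\
  r * (circ (pot g sin) cos x y r - circ (pot g cos) sin x y r) = 0.

Lemma pot_identities_C1 (g gx gy : R -> R -> R) (x y r : R) :
  C1 g gx gy -> box_supp 3 g -> 0 <= r ->
  (forall s t, 0 <= s <= r -> Rabs (x + s * cos t) <= 1 /\ Rabs (y + s * sin t) <= 1) ->
  pot_law g x y r.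
Proof.
  intros H Hsupp Hr Hdisc.
  assert (Ccos := continuous_cos). assert (Csin := continuous_sin).
  assert (Cone := cont_one).
  assert (HC := pot_C1 g gx gy cos H Ccos). assert (HS := pot_C1 g gx gy sin H Csin).
  assert (Hcurl : forall x y, pot gx sin x y = pot gy cos x y)
    by (intros; now apply (pot_curl g)).
  assert (Hg := proj1 H).
  assert (Hdiv : forall s k, 0 <= s <= r -> (forall t, continuous k t) ->
    circ (fun x y => pot gx cos x y + pot gy sin x y) k x y s
      = - 2 * PI * circ g k x y s).
  { intros s k Hs Hk. rewrite <- circ_scal by assumption.
    apply circ_ext. intros t. apply (pot_div g); [assumption|].
    intros t'. destruct (Hdisc s t Hs). now apply box_supp_far. }
  destruct (curl_free_mean _ _ _ _ _ _ x y r HC HS Hcurl Hr) as [E1 E2].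
  repeat split.
  - rewrite E1, <- RInt_Rmult by now apply ex_pot.
    apply RInt_Rext; [assumption|]. intros s Hs. apply Hdiv; [lra | assumption].
  - rewrite E2, <- RInt_Rmult by now apply ex_pot.
    apply RInt_Rext; [assumption|]. intros s Hs. apply Hdiv; [lra | assumption].
  - rewrite (disc_divergence _ _ _ _ _ _ x y r HC HS), <- RInt_Rmult.
    + apply RInt_Rext; [assumption|]. intros s Hs.
      rewrite Hdiv by (auto; lra). ring.
    + apply ex_RInt_cont. intros s. apply continuous_Rmult; [cont|].
      apply (cont_circ g one (fun _ => x) (fun _ => y) (fun s => s)); cont.
  (* The circulation is the flux of the field turned by a right angle, [(pot g sin, - pot g cos)],
     whose divergence is the curl of the original field, namely zero. *)
  - assert (HN : C1 (fun x y => -1 * pot g cos x y) (fun x y => -1 * pot gx cos x y)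
      (fun x y => -1 * pot gy cos x y)).
    { destruct HC as (D1 & D2 & D3 & D4 & D5).
      split; [|split; [|split; [|split]]]; try now apply cont2_scal.
      - intros x' y'. now apply is_derive_scal.
      - intros x' y'. now apply is_derive_scal. }
    assert (E := disc_divergence _ _ _ _ _ _ x y r HS HN).
    rewrite (circ_scal sin (pot g cos) x y r (-1) (proj1 HC) Csin) in E.
    replace (circ (pot g sin) cos x y r - circ (pot g cos) sin x y r) with
      (circ (pot g sin) cos x y r + -1 * circ (pot g cos) sin x y r) by ring.
    rewrite E, (RInt_Rext _ (fun _ => 0)).
    + rewrite RInt_Rconst. ring.
    + assumption.
    + intros s _. unfold circ. rewrite (RInt_Rext _ (fun _ => 0)).
      * rewrite RInt_Rconst. ring.
      * apply two_PI_pos.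
      * intros t _. rewrite Hcurl. ring.
Qed.

(** * From smooth to continuous densities by Steklov averages *)

(** With a primitive [Phi] of [f] the average is [(Phi (x + d) - Phi x) / d], which is
    differentiable even though [f] is only continuous. *)
Lemma average_derive (f : R -> R) (d x : R) :
  (forall t, continuous f t) -> d <> 0 ->
  is_derive (fun x => RInt (fun t => f (x + d * t)) 0 1) x ((f (x + d) - f x) / d).
Proof.
  intros Hf Hd.
  set (Phi := fun x => RInt f 0 x).
  assert (HPhi : forall z, is_derive Phi z (f z)).
  { intros z. apply (is_derive_RInt f Phi 0 z); [|apply Hf].
    apply filter_forall. intros b. apply (RInt_correct (V := R_CompleteNormedModule)).
    now apply ex_RInt_cont. }
  assert (Haff : forall z t, is_derive (fun t => Phi (z + d * t)) t (f (z + d * t) * d)).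
  { intros z t. rewrite Rmult_comm.
    apply (is_derive_comp Phi (fun t => z + d * t) t (f (z + d * t)) d).
    - apply HPhi.
    - auto_derive; [exact I | ring]. }
  apply (is_derive_ext (fun z => (Phi (z + d) - Phi z) * / d)).
  - intros z.
    assert (E := FTC (fun t => Phi (z + d * t)) (fun t => f (z + d * t) * d) 0 1 (Haff z)
      ltac:(intros; cont)).
    cbv beta in E. rewrite Rmult_1_r, Rmult_0_r, Rplus_0_r in E. rewrite <- E.
    rewrite (RInt_Rext _ (fun t => d * f (z + d * t))); [|lra|intros; ring].
    rewrite RInt_Rmult by (apply ex_RInt_cont; intros t; cont).
    eqR.
    field. assumption.
  - apply is_derive_Rmult_const.
    apply (is_derive_minus (V := R_NormedModule) (fun z => Phi (z + d)) Phi); [|apply HPhi].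
    replace (f (x + d)) with (scal 1 (f (x + d)))
      by (unfold scal; simpl; unfold mult; simpl; ring).
    apply (is_derive_comp Phi (fun z => z + d)); [apply HPhi|].
    auto_derive; [exact I | ring].
Qed.

(** The mean of [g] over a square of side [d] with corner [(x, y)]. Integrating over the fixed unit
    square keeps the formula meaningful, and continuous in [d], at [d = 0]. *)
Definition steklov (g : R -> R -> R) (d x y : R) : R :=
  RInt (fun s => RInt (fun t => g (x + d * s) (y + d * t)) 0 1) 0 1.

Lemma jcont_steklov (g : R -> R -> R) : cont2 g -> jcont (steklov g).
Proof.
  intros Hg p. unfold steklov.
  apply (continuous_RInt_param (fun (q : (R * R) * R) s =>
    RInt (fun t => g (snd (fst q) + fst (fst q) * s) (snd q + fst (fst q) * t)) 0 1)).
  intros q.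
  apply (continuous_RInt_param (fun (q : ((R * R) * R) * R) t =>
    g (snd (fst (fst q)) + fst (fst (fst q)) * snd q)
      (snd (fst q) + fst (fst (fst q)) * t))).
  intros r. cont.
Qed.

Lemma steklov_0 (g : R -> R -> R) (x y : R) : steklov g 0 x y = g x y.
Proof.
  unfold steklov. rewrite (RInt_Rext _ (fun _ => g x y)); [rewrite RInt_Rconst; ring|lra|].
  intros s _. rewrite (RInt_Rext _ (fun _ => g x y)); [rewrite RInt_Rconst; ring|lra|].
  intros t _. now rewrite !Rmult_0_l, !Rplus_0_r.
Qed.

Lemma steklov_C1 (g : R -> R -> R) (d : R) :
  cont2 g -> d <> 0 -> exists hx hy, C1 (steklov g d) hx hy.
Proof.
  intros Hg Hd.
  assert (HA : cont2 (fun x y => RInt (fun t => g x (y + d * t)) 0 1)).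
  { intros p. apply (continuous_RInt_param (fun (q : R * R) t => g (fst q) (snd q + d * t))).
    intros q. cont. }
  exists (fun x y => (RInt (fun t => g (x + d) (y + d * t)) 0 1
                   - RInt (fun t => g x (y + d * t)) 0 1) / d).
  exists (fun x y => RInt (fun s => (g (x + d * s) (y + d) - g (x + d * s) y) / d) 0 1).
  split; [|split; [|split; [|split]]].
  - apply (jcont_cont2 (steklov g) d). now apply jcont_steklov.
  - intros p. unfold Rdiv. apply continuous_Rmult; [|cont].
    apply continuous_Rminus; [|apply HA].
    apply (cont2_comp _ (fun q : R * R => fst q + d) (fun q : R * R => snd q) p HA); cont.
  - intros p. apply (continuous_RInt_param (fun (q : R * R) s =>
      (g (fst q + d * s) (snd q + d) - g (fst q + d * s) (snd q)) / d)).
    intros q. unfold Rdiv. cont.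
  - intros x y. unfold steklov.
    apply (average_derive (fun z => RInt (fun t => g z (y + d * t)) 0 1)); [|assumption].
    intros z. apply (cont2_comp _ (fun z => z) (fun _ => y) z HA); cont.
  - intros x y. unfold steklov.
    apply (is_derive_RInt_param_cont
      (fun y s => RInt (fun t => g (x + d * s) (y + d * t)) 0 1)
      (fun y s => (g (x + d * s) (y + d) - g (x + d * s) y) / d)).
    + lra.
    + apply filter_forall. intros y' s _.
      apply (average_derive (fun z => g (x + d * s) z)); [|assumption].
      intros z. cont.
    + apply filter_forall. intros y'. apply ex_RInt_cont. intros s.
      apply (cont2_comp _ (fun s => x + d * s) (fun _ => y') s HA); cont.
    + intros s _. unfold Rdiv. cont.
    + intros s _. unfold Rdiv. cont.
Qed.

Lemma steklov_supp (g : R -> R -> R) (d : R) :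
  box_supp 2 g -> 0 <= d <= 1 -> box_supp 3 (steklov g d).
Proof.
  intros Hg Hd x y H. unfold steklov.
  rewrite (RInt_Rext _ (fun _ => 0)); [rewrite RInt_Rconst; ring|lra|].
  intros s Hs.
  rewrite (RInt_Rext _ (fun _ => 0)); [rewrite RInt_Rconst; ring|lra|].
  intros t Ht. apply Hg.
  assert (0 <= d * s <= 1) by nra. assert (0 <= d * t <= 1) by nra.
  destruct H as [H|H]; [left | right]; revert H; unfold Rabs;
    repeat destruct Rcase_abs; lra.
Qed.

Lemma continuous_eq_0 (f : R -> R) :
  continuous f 0 -> (forall d, 0 < d < 1 -> f d = 0) -> f 0 = 0.
Proof.
  intros Hf H. destruct (Req_dec (f 0) 0) as [E|E]; [exact E | exfalso].
  assert (He : 0 < Rabs (f 0)) by now apply Rabs_pos_lt.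
  destruct (proj1 (filterlim_locally _ _) Hf (mkposreal _ He)) as [d Hd].
  set (z := Rmin (d / 2) (1 / 2)).
  assert (Hz : 0 < z < 1 /\ z < d).
  { unfold z. assert (H' := cond_pos d). unfold Rmin. destruct Rle_dec; lra. }
  assert (B : ball 0 d z).
  { change (Rabs (z - 0) < d). rewrite Rminus_0_r, Rabs_pos_eq; lra. }
  assert (B' := Hd z B). change (Rabs (f z - f 0) < Rabs (f 0)) in B'.
  rewrite H in B' by lra.
  replace (0 - f 0) with (- f 0) in B' by ring. rewrite Rabs_Ropp in B'. lra.
Qed.

(** For [0 < d < 1] the averages are C1 with support in the larger box, so they satisfy the law.
    Both sides of each identity are continuous in [d] at 0, where the average is [g] itself. *)
Lemma pot_identities (g : R -> R -> R) (x y r : R) :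
  cont2 g -> box_supp 2 g -> 0 <= r ->
  (forall s t, 0 <= s <= r -> Rabs (x + s * cos t) <= 1 /\ Rabs (y + s * sin t) <= 1) ->
  pot_law g x y r.
Proof.
  intros Hg Hsupp Hr Hdisc.
  assert (HC : forall d, 0 < d < 1 -> exists hx hy, C1 (steklov g d) hx hy).
  { intros d Hd. apply steklov_C1; [assumption | lra]. }
  assert (HI : forall d, 0 < d < 1 -> pot_law (steklov g d) x y r).
  { intros d Hd. destruct (HC d Hd) as (hx & hy & Hh).
    assert (HS : box_supp 3 (steklov g d)) by (apply steklov_supp; [assumption | lra]).
    exact (pot_identities_C1 _ _ _ x y r Hh HS Hr Hdisc). }
  assert (HJ := jcont_steklov g Hg).
  assert (Ccos := continuous_cos). assert (Csin := continuous_sin).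
  assert (Cone := cont_one).
  assert (JC := jcont_pot _ _ HJ Ccos). assert (JS := jcont_pot _ _ HJ Csin).
  assert (E0 : steklov g 0 = g).
  { apply functional_extensionality. intros u. apply functional_extensionality. intros v.
    apply steklov_0. }
  assert (Hpot : forall k, (forall t, continuous k t) ->
    continuous (fun d => pot (steklov g d) k x y) 0).
  { intros k Hk. apply (jcont_at (fun d => pot (steklov g d) k) (fun d => d)
      (fun _ => x) (fun _ => y)); [now apply jcont_pot | cont ..]. }
  assert (Hcirc : forall k k', (forall t, continuous k t) -> (forall t, continuous k' t) ->
    continuous (fun d => circ (pot (steklov g d) k) k' x y r) 0).
  { intros k k' Hk Hk'.
    apply (jcont_circ (fun d => pot (steklov g d) k) k' (fun _ => x) (fun _ => y) (fun _ => r) 0);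
      [now apply jcont_pot | assumption | apply continuous_const ..]. }
  assert (Hint : forall k, (forall t, continuous k t) ->
    continuous (fun d => RInt (fun s => circ (steklov g d) k x y s) 0 r) 0).
  { intros k Hk. apply (continuous_RInt_param (fun d s => circ (steklov g d) k x y s)).
    intros q. apply (jcont_circ (fun q : R * R => steklov g (fst q)) k (fun _ => x)
      (fun _ => y) (fun q => snd q) q); try cont.
    intros p. apply (jcont_at (steklov g) (fun q => fst (fst (fst q)))
      (fun q => snd (fst q)) (fun q => snd q)); try exact HJ; cont. }
  assert (Hint' : continuous (fun d => RInt (fun s => s * circ (steklov g d) one x y s) 0 r) 0).
  { apply (continuous_RInt_param (fun d s => s * circ (steklov g d) one x y s)).
    intros q. apply continuous_Rmult; [cont|].
    apply (jcont_circ (fun q : R * R => steklov g (fst q)) one (fun _ => x)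
      (fun _ => y) (fun q => snd q) q); try cont.
    intros p. apply (jcont_at (steklov g) (fun q => fst (fst (fst q)))
      (fun q => snd (fst q)) (fun q => snd q)); try exact HJ; cont. }
  assert (C1c := Hpot _ Ccos). assert (C1s := Hpot _ Csin).
  assert (Cco := Hcirc _ _ Ccos Cone). assert (Cso := Hcirc _ _ Csin Cone).
  assert (Ccc := Hcirc _ _ Ccos Ccos). assert (Css := Hcirc _ _ Csin Csin).
  assert (Csc := Hcirc _ _ Csin Ccos). assert (Ccs := Hcirc _ _ Ccos Csin).
  assert (Cic := Hint _ Ccos). assert (Cis := Hint _ Csin).
  rewrite <- E0. repeat split; apply Rminus_diag_uniq.
  - apply (continuous_eq_0 (fun d => circ (pot (steklov g d) cos) one x y r
      - 2 * PI * pot (steklov g d) cos x y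
      - - 2 * PI * RInt (fun s => circ (steklov g d) cos x y s) 0 r)).
    + apply continuous_Rminus; [apply continuous_Rminus|apply continuous_Rmult];
        [exact Cco | apply continuous_Rmult; [apply continuous_const | exact C1c]
        | apply continuous_const | exact Cic].
    + intros d Hd. rewrite (proj1 (HI d Hd)). ring.
  - apply (continuous_eq_0 (fun d => circ (pot (steklov g d) sin) one x y r
      - 2 * PI * pot (steklov g d) sin x y
      - - 2 * PI * RInt (fun s => circ (steklov g d) sin x y s) 0 r)).
    + apply continuous_Rminus; [apply continuous_Rminus|apply continuous_Rmult];
        [exact Cso | apply continuous_Rmult; [apply continuous_const | exact C1s]
        | apply continuous_const | exact Cis].
    + intros d Hd. rewrite (proj1 (proj2 (HI d Hd))). ring.
  - apply (continuous_eq_0 (fun d => r * (circ (pot (steklov g d) cos) cos x y r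
      + circ (pot (steklov g d) sin) sin x y r)
      - - 2 * PI * RInt (fun s => s * circ (steklov g d) one x y s) 0 r)).
    + apply continuous_Rminus; apply continuous_Rmult;
        [apply continuous_const | apply continuous_Rplus; [exact Ccc | exact Css]
        | apply continuous_const | exact Hint'].
    + intros d Hd. rewrite (proj1 (proj2 (proj2 (HI d Hd)))). ring.
  - apply (continuous_eq_0 (fun d => r * (circ (pot (steklov g d) sin) cos x y r
      - circ (pot (steklov g d) cos) sin x y r) - 0)).
    + apply continuous_Rminus; [apply continuous_Rmult|];
        [apply continuous_const | apply continuous_Rminus; [exact Csc | exact Ccs]
        | apply continuous_const].
    + intros d Hd. rewrite (proj2 (proj2 (proj2 (HI d Hd)))). ring.
Qed.

(** * Iterated integrals, maxima on the disc and the maximum principle *)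

(** As functions of the upper limit [b], both sides vanish at [a] and have the same derivative. *)
Lemma Fubini (F : R -> R -> R) (a b c d : R) :
  c <= d -> cont2 F ->
  RInt (fun s => RInt (fun t => F s t) c d) a b
    = RInt (fun t => RInt (fun s => F s t) a b) c d.
Proof.
  intros Hcd HF.
  assert (CF : forall t, forall s, continuous (fun s => F s t) s) by (intros; cont).
  assert (Hin : forall x, ex_RInt (fun t => RInt (fun s => F s t) a x) c d).
  { intros x. apply ex_RInt_cont.
    apply (continuous_RInt_param (fun t s => F s t)). intros q. cont. }
  rewrite (FTC (fun x => RInt (fun t => RInt (fun s => F s t) a x) c d)).
  - rewrite (RInt_Rext (fun t => RInt (fun s => F s t) a a) (fun _ => 0)).
    + rewrite RInt_Rconst. eqR. ring.
    + exact Hcd.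
    + intros t _. apply (RInt_point (V := R_CompleteNormedModule)).
  - intros x. apply (is_derive_RInt_param_cont (fun x t => RInt (fun s => F s t) a x) F).
    + exact Hcd.
    + apply filter_forall. intros y t _.
      apply (is_derive_RInt (V := R_NormedModule) (fun s => F s t) _ a y); [|cont].
      apply filter_forall. intros z. apply (RInt_correct (V := R_CompleteNormedModule)).
      now apply ex_RInt_cont.
    + now apply filter_forall.
    + intros t _. apply (cont2_comp F (fun _ => x) (fun t => t) t HF); cont.
    + intros t _. apply HF.
  - apply (continuous_RInt_param F). exact HF.
Qed.

(** Maximise in [t] for each [s], then in [s]. The chosen maximiser [m s] may jump, but the maximal
    value [F s (m s)] is continuous by [tube]. *)
Lemma rect_max (F : R -> R -> R) (a b c d : R) :
  a <= b -> c <= d -> cont2 F ->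
  exists s0 t0, a <= s0 <= b /\ c <= t0 <= d /\
    forall s t, a <= s <= b -> c <= t <= d -> F s t <= F s0 t0.
Proof.
  intros Hab Hcd HF.
  assert (HM : forall s, exists m, (forall t, c <= t <= d -> F s t <= F s m) /\ c <= m <= d).
  { intros s. apply continuity_ab_maj; [exact Hcd|]. intros t _.
    apply continuity_pt_filterlim. assert (C : continuous (fun t => F s t) t) by cont. exact C. }
  set (m := fun s => proj1_sig (constructive_indefinite_description _ (HM s))).
  assert (Hm : forall s, (forall t, c <= t <= d -> F s t <= F s (m s)) /\ c <= m s <= d)
    by (intros s; exact (proj2_sig (constructive_indefinite_description _ (HM s)))).
  destruct (continuity_ab_maj (fun s => F s (m s)) a b Hab) as [s0 [H0 Hs0]].
  - intros s _. apply continuity_pt_filterlim.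
    apply (proj2 (filterlim_locally (fun s => F s (m s)) (F s (m s)))). intros eps.
    generalize (tube F c d s (fun t _ => HF (s, t)) eps). apply filter_imp.
    intros s' H. change (Rabs (F s' (m s') - F s (m s)) < eps).
    destruct (Hm s) as [M1 M2]. destruct (Hm s') as [M1' M2'].
    assert (A1 := H _ M2). assert (A2 := H _ M2').
    assert (B1 := M1 _ M2'). assert (B2 := M1' _ M2).
    apply Rabs_lt_between in A1, A2. apply Rabs_lt_between. lra.
  - exists s0, (m s0). split; [exact Hs0|]. split; [apply Hm|].
    intros s t Hs Ht. eapply Rle_trans; [apply Hm, Ht | apply H0, Hs].
Qed.

Lemma unit_circle_angle (x y : R) :
  x * x + y * y = 1 -> exists t, 0 <= t <= 2 * PI /\ x = cos t /\ y = sin t.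
Proof.
  intros H. assert (Hx : -1 <= x <= 1) by nra.
  assert (Hb := acos_bound x). assert (HPI := PI_RGT_0).
  assert (Hs : sin (acos x) = Rabs y).
  { rewrite sin_acos by exact Hx. rewrite <- sqrt_Rsqr_abs. f_equal. unfold Rsqr. lra. }
  destruct (Rle_dec 0 y) as [Hy|Hy].
  - exists (acos x). split; [lra|].
    rewrite cos_acos, Hs, Rabs_pos_eq by assumption. easy.
  - exists (2 * PI - acos x). split; [lra|].
    replace (2 * PI - acos x) with (- acos x + 2 * PI) by ring.
    rewrite cos_plus, sin_plus, cos_2PI, sin_2PI, cos_neg, sin_neg, cos_acos, Hs by assumption.
    rewrite Rabs_left by lra. lra.
Qed.

Lemma polar (x y : R) :
  exists t, 0 <= t <= 2 * PI /\
    x = sqrt (x * x + y * y) * cos t /\ y = sqrt (x * x + y * y) * sin t.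
Proof.
  assert (Hn : 0 <= x * x + y * y) by nra.
  destruct (Req_dec (x * x + y * y) 0) as [E|E].
  - exists 0. rewrite E, sqrt_0. assert (HPI := PI_RGT_0).
    repeat split; nra.
  - assert (Hr : 0 < sqrt (x * x + y * y)) by (apply sqrt_lt_R0; lra).
    assert (Hr2 := sqrt_sqrt _ Hn).
    set (r := sqrt (x * x + y * y)) in *.
    destruct (unit_circle_angle (x / r) (y / r)) as (t & Ht & Hx & Hy).
    { transitivity ((x * x + y * y) / (r * r)); [field; lra|].
      rewrite Hr2. field. exact E. }
    exists t. split; [exact Ht|]. rewrite <- Hx, <- Hy. split; field; lra.
Qed.

Lemma disc_max (v : R -> R -> R) :
  (forall x y, x * x + y * y <= 1 ->
     continuous (fun q : R * R => v (fst q) (snd q)) (x, y)) ->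
  exists x0 y0, x0 * x0 + y0 * y0 <= 1 /\
    forall x y, x * x + y * y <= 1 -> v x y <= v x0 y0.
Proof.
  intros Hv.
  (* The retraction of [R] onto [[0, 1]]. Since [v] is controlled only on the closed disc, clipping
     the radius makes the function in polar coordinates continuous on the whole plane, as [rect_max]
     requires. *)
  set (clip := fun s => (1 + Rabs s - Rabs (s - 1)) / 2).
  assert (Hclip : forall s, 0 <= clip s <= 1).
  { intros s. unfold clip, Rabs. repeat destruct Rcase_abs; lra. }
  assert (Hclip1 : forall s, 0 <= s <= 1 -> clip s = s).
  { intros s Hs. unfold clip, Rabs. repeat destruct Rcase_abs; lra. }
  assert (Cclip : forall s, continuous clip s).
  { intros s. unfold clip, Rdiv.
    assert (Cabs : forall s, continuous Rabs s) by (intros; apply continuous_Rabs).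
    cont. }
  assert (Hdisc : forall s t, clip s * cos t * (clip s * cos t) + clip s * sin t * (clip s * sin t) <= 1).
  { intros s t. assert (Hcs := sin2_cos2 t). unfold Rsqr in Hcs.
    replace (_ + _) with (clip s * clip s * (sin t * sin t + cos t * cos t)) by ring.
    rewrite Hcs. assert (H := Hclip s). nra. }
  destruct (rect_max (fun s t => v (clip s * cos t) (clip s * sin t)) 0 1 0 (2 * PI))
    as (s0 & t0 & Hs0 & Ht0 & Hmax).
  - lra.
  - apply two_PI_pos.
  - intros [s t].
    apply (continuous_comp_2 (fun q : R * R => clip (fst q) * cos (snd q))
      (fun q : R * R => clip (fst q) * sin (snd q)) v (s, t)).
    + cont.
    + cont.
    + apply Hv. apply Hdisc.
  - exists (clip s0 * cos t0), (clip s0 * sin t0). split; [apply Hdisc|].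
    intros x y Hxy. destruct (polar x y) as (t & Ht & Hx & Hy).
    assert (Hr0 := sqrt_pos (x * x + y * y)).
    assert (Hr1 : sqrt (x * x + y * y) <= 1) by (rewrite <- sqrt_1; now apply sqrt_le_1_alt).
    assert (H := Hmax (sqrt (x * x + y * y)) t (conj Hr0 Hr1) Ht). cbv beta in H.
    rewrite (Hclip1 (sqrt _)), <- Hx, <- Hy in H by lra. exact H.
Qed.

Definition circle_mvp (v : R -> R -> R) : Prop :=
  forall x y, x * x + y * y < 1 -> exists delta, 0 < delta /\
    forall r, 0 < r < delta -> circ v one x y r = 2 * PI * v x y.

Lemma continuous_circle (v : R -> R -> R) (x y r t : R) :
  continuous (fun q : R * R => v (fst q) (snd q)) (x + r * cos t, y + r * sin t) ->
  continuous (fun t => v (x + r * cos t) (y + r * sin t)) t.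
Proof.
  intros H. apply (continuous_comp_2 (fun t => x + r * cos t) (fun t => y + r * sin t) v t);
    [cont | cont | exact H].
Qed.

Lemma circ_norm2 (x y r : R) :
  circ (fun x y => x * x + y * y) one x y r = 2 * PI * (x * x + y * y + r * r).
Proof.
  unfold circ, one.
  rewrite (RInt_Rext _ (fun t => (x * x + y * y + r * r) + 2 * r * (x * cos t + y * sin t))).
  - rewrite (FTC (fun t => (x * x + y * y + r * r) * t + 2 * r * (x * sin t - y * cos t))).
    + rewrite sin_2PI, cos_2PI, sin_0, cos_0. ring.
    + intros t. auto_derive; [exact I | ring].
    + intros t. cont.
  - apply two_PI_pos.
  - intros t _. assert (Hcs := sin2_cos2 t). unfold Rsqr in Hcs.
    transitivity (x * x + y * y + r * r * (sin t * sin t + cos t * cos t)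
      + 2 * r * (x * cos t + y * sin t)); [ring|]. rewrite Hcs. ring.
Qed.

(** The 3 comes from [(|z| + r)^2 <= |z|^2 + 2 r + r^2 <= |z|^2 + 3 r] for [|z|, r <= 1]. It avoids
    square roots when a small radius is chosen. *)
Lemma shrink_circle (x y r t : R) :
  0 <= r -> x * x + y * y + 3 * r <= 1 ->
  (x + r * cos t) * (x + r * cos t) + (y + r * sin t) * (y + r * sin t) <= 1.
Proof.
  intros Hr H. assert (Hcs := sin2_cos2 t). unfold Rsqr in Hcs.
  assert (E : (x + r * cos t) * (x + r * cos t) + (y + r * sin t) * (y + r * sin t)
    = x * x + y * y + r * r * (sin t * sin t + cos t * cos t)
      + r * (2 * (x * cos t + y * sin t))) by ring.
  rewrite E, Hcs.
  assert (2 * (x * cos t + y * sin t) <= 2).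
  { assert (H1 := Rle_0_sqr (x - cos t)). assert (H2 := Rle_0_sqr (y - sin t)).
    unfold Rsqr in *. nra. }
  assert (r * r <= r) by nra. nra.
Qed.

(* Adding [k * |z|^2] makes the mean over every small circle strictly exceed
   the central value, which rules out an interior maximum. *)
Lemma max_principle (v : R -> R -> R) (e : R) :
  (forall x y, x * x + y * y <= 1 ->
     continuous (fun q : R * R => v (fst q) (snd q)) (x, y)) ->
  circle_mvp v ->
  (forall t, v (cos t) (sin t) <= e) ->
  forall x y, x * x + y * y <= 1 -> v x y <= e.
Proof.
  intros Hv Hm Hb x y Hxy. apply le_epsilon. intros k Hk.
  set (w := fun x y => v x y + k * (x * x + y * y)).
  assert (Cw : forall x y, x * x + y * y <= 1 ->
     continuous (fun q : R * R => w (fst q) (snd q)) (x, y)).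
  { intros x' y' H. apply continuous_Rplus; [now apply Hv | cont]. }
  destruct (disc_max w Cw) as (x0 & y0 & H0 & Hmax).
  assert (Hw : w x y <= w x0 y0) by now apply Hmax.
  assert (Hvw : v x y <= w x y) by (unfold w; nra).
  destruct (Rle_lt_or_eq_dec _ _ H0) as [Hlt|Heq].
  - exfalso. destruct (Hm x0 y0 Hlt) as (delta & Hd & Hmean).
    set (r := Rmin (delta / 2) ((1 - (x0 * x0 + y0 * y0)) / 3)).
    assert (Hr : 0 < r < delta /\ x0 * x0 + y0 * y0 + 3 * r <= 1).
    { unfold r, Rmin. destruct Rle_dec; lra. }
    destruct Hr as [Hr1 Hr2].
    assert (Hin : forall t, (x0 + r * cos t) * (x0 + r * cos t)
       + (y0 + r * sin t) * (y0 + r * sin t) <= 1) by (intros; apply shrink_circle; lra).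
    assert (Cvt : forall t, continuous (fun t => v (x0 + r * cos t) (y0 + r * sin t)) t)
      by (intros t; apply continuous_circle, Hv, Hin).
    assert (Cone := cont_one).
    assert (E : circ w one x0 y0 r = 2 * PI * (w x0 y0 + k * (r * r))).
    { transitivity (circ v one x0 y0 r + k * circ (fun x y => x * x + y * y) one x0 y0 r).
      - unfold circ. rewrite <- RInt_Rmult, <- RInt_Rplus.
        + apply RInt_Rext; [apply two_PI_pos|]. intros t _. unfold w. ring.
        + apply ex_RInt_cont. intros t. cont.
        + apply ex_RInt_cont. intros t. cont.
        + apply ex_RInt_cont. intros t. cont.
      - rewrite Hmean, circ_norm2 by exact Hr1. unfold w. ring. }
    assert (L : circ w one x0 y0 r <= 2 * PI * w x0 y0).
    { unfold circ. rewrite <- (Rminus_0_r (2 * PI)) at 2. rewrite <- RInt_Rconst.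
      apply RInt_le.
      - apply two_PI_pos.
      - apply ex_RInt_cont. intros t. apply continuous_Rmult; [|cont].
        apply continuous_circle, Cw, Hin.
      - apply ex_RInt_cont. intros t. cont.
      - intros t _. unfold one. rewrite Rmult_1_r. apply Hmax, Hin. }
    assert (HPI := PI_RGT_0).
    assert (0 < k * (r * r)) by (apply Rmult_lt_0_compat; nra). nra.
  (* The maximum of [w] lies on the unit circle, where [w] is [v + k] and hence at most [e + k]. *)
  - destruct (unit_circle_angle x0 y0 Heq) as (t & _ & Hx & Hy).
    assert (H := Hb t). rewrite <- Hx, <- Hy in H. unfold w in Hw, Hvw. rewrite Heq in Hw. lra.
Qed.

(** * The Poisson kernel and the Poisson integral *)

Definition den (c s x y : R) : R := (c - x) * (c - x) + (s - y) * (s - y).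

(* Writing [e = c + i s] and [z = x + i y], these are the real and imaginary
   parts of [(e + z) / (e - z)] when [|e| = 1], and of [e / (e - z)^2], half
   its [z]-derivative. *)
Definition poisson (c s x y : R) : R := (c * c + s * s - x * x - y * y) / den c s x y.
Definition poisson_conj (c s x y : R) : R := 2 * (y * c - x * s) / den c s x y.
Definition ker_re (c s x y : R) : R :=
  (c * ((c - x) * (c - x) - (s - y) * (s - y)) + 2 * s * (c - x) * (s - y))
  / (den c s x y * den c s x y).
Definition ker_im (c s x y : R) : R :=
  (s * ((c - x) * (c - x) - (s - y) * (s - y)) - 2 * c * (c - x) * (s - y))
  / (den c s x y * den c s x y).

Lemma den_pos (t x y : R) : x * x + y * y < 1 -> 0 < den (cos t) (sin t) x y.
Proof.
  intros H. unfold den. assert (Hcs := sin2_cos2 t). unfold Rsqr in Hcs.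
  destruct (Req_dec (cos t) x) as [E1|E1]; [destruct (Req_dec (sin t) y) as [E2|E2]|].
  - exfalso. rewrite <- E1, <- E2 in H. lra.
  - assert (0 < (sin t - y) * (sin t - y)) by (apply Rsqr_pos_lt; lra).
    assert (H1 := Rle_0_sqr (cos t - x)). unfold Rsqr in H1. lra.
  - assert (0 < (cos t - x) * (cos t - x)) by (apply Rsqr_pos_lt; lra).
    assert (H1 := Rle_0_sqr (sin t - y)). unfold Rsqr in H1. lra.
Qed.

(** The chain rule along a path for the real part of a holomorphic function; with
    [poisson_conj_derive] it encodes the Cauchy-Riemann equations of the kernel. *)
Lemma poisson_derive (c s : R) (X Y : R -> R) (t X' Y' : R) :
  is_derive X t X' -> is_derive Y t Y' -> den c s (X t) (Y t) <> 0 ->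
  is_derive (fun t => poisson c s (X t) (Y t)) t
    (2 * (ker_re c s (X t) (Y t) * X' - ker_im c s (X t) (Y t) * Y')).
Proof.
  intros HX HY Hd. unfold poisson, ker_re, ker_im, den in *.
  auto_derive.
  - repeat split; try (eexists; eassumption). exact Hd.
  - rewrite (is_derive_unique _ _ _ HX : Derive (fun x : R => X x) t = X'),
      (is_derive_unique _ _ _ HY : Derive (fun x : R => Y x) t = Y').
    field. exact Hd.
Qed.

Lemma poisson_conj_derive (c s : R) (X Y : R -> R) (t X' Y' : R) :
  is_derive X t X' -> is_derive Y t Y' -> den c s (X t) (Y t) <> 0 ->
  is_derive (fun t => poisson_conj c s (X t) (Y t)) t
    (2 * (ker_im c s (X t) (Y t) * X' + ker_re c s (X t) (Y t) * Y')).
Proof.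
  intros HX HY Hd. unfold poisson_conj, ker_re, ker_im, den in *.
  auto_derive.
  - repeat split; try (eexists; eassumption). exact Hd.
  - rewrite (is_derive_unique _ _ _ HX : Derive (fun x : R => X x) t = X'),
      (is_derive_unique _ _ _ HY : Derive (fun x : R => Y x) t = Y').
    field. exact Hd.
Qed.

Section KernelContinuity.
Context {T : UniformSpace} (A B X Y : T -> R) (p : T).
Hypotheses (HA : continuous A p) (HB : continuous B p)
  (HX : continuous X p) (HY : continuous Y p)
  (Hd : den (A p) (B p) (X p) (Y p) <> 0).

Lemma continuous_poisson :
  continuous (fun q => poisson (A q) (B q) (X q) (Y q)) p.
Proof.
  unfold poisson. apply continuous_Rdiv; [cont | unfold den; cont | exact Hd].
Qed.

Lemma continuous_ker_re :
  continuous (fun q => ker_re (A q) (B q) (X q) (Y q)) p.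
Proof.
  unfold ker_re. apply continuous_Rdiv; [cont | unfold den; cont |].
  now apply Rmult_integral_contrapositive.
Qed.

Lemma continuous_ker_im :
  continuous (fun q => ker_im (A q) (B q) (X q) (Y q)) p.
Proof.
  unfold ker_im. apply continuous_Rdiv; [cont | unfold den; cont |].
  now apply Rmult_integral_contrapositive.
Qed.
End KernelContinuity.

Lemma in_unit_disc (x y s t : R) :
  sqrt (x * x + y * y) + Rabs s < 1 ->
  (x + s * cos t) * (x + s * cos t) + (y + s * sin t) * (y + s * sin t) < 1.
Proof.
  intros H. assert (Hn : 0 <= x * x + y * y) by nra.
  assert (Hp := sqrt_pos (x * x + y * y)). assert (Hq := sqrt_sqrt _ Hn).
  set (m := sqrt (x * x + y * y)) in *.
  assert (Ha := Rabs_pos s).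
  assert (Hs : s * s = Rabs s * Rabs s)
    by (rewrite <- Rabs_mult, Rabs_pos_eq; nra).
  assert (Hcs := sin2_cos2 t). unfold Rsqr in Hcs.
  assert (E : (x + s * cos t) * (x + s * cos t) + (y + s * sin t) * (y + s * sin t)
    = m * m + Rabs s * Rabs s + 2 * (s * (x * cos t + y * sin t))).
  { rewrite Hq, <- Hs. transitivity (x * x + y * y + s * s * (sin t * sin t + cos t * cos t)
      + 2 * (s * (x * cos t + y * sin t))); [ring|]. rewrite Hcs. ring. }
  assert (HC : Rabs (x * cos t + y * sin t) <= m).
  { rewrite <- (Rabs_pos_eq m Hp). apply Rsqr_le_abs_0. unfold Rsqr. rewrite Hq.
    assert (H1 := Rle_0_sqr (x * sin t - y * cos t)). unfold Rsqr in H1.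
    replace (x * x + y * y) with ((x * x + y * y) * (sin t * sin t + cos t * cos t))
      by (rewrite Hcs; ring). lra. }
  assert (HL : s * (x * cos t + y * sin t) <= Rabs s * m).
  { eapply Rle_trans; [apply Rle_abs|]. rewrite Rabs_mult.
    now apply Rmult_le_compat_l. }
  rewrite E. assert ((m + Rabs s) * (m + Rabs s) < 1) by nra. nra.
Qed.

(** By Cauchy-Riemann in polar coordinates, the radial derivative of the kernel times the radius is
    the angular derivative of its conjugate, which integrates to zero over a turn. So the circle
    integral does not depend on the radius. *)
Lemma poisson_mvp (th x y r : R) :
  0 <= r -> sqrt (x * x + y * y) + r < 1 ->
  circ (poisson (cos th) (sin th)) one x y r = 2 * PI * poisson (cos th) (sin th) x y.
Proof.
  intros Hr H. rewrite <- circ_0.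
  set (c := cos th). set (s := sin th).
  assert (Hden : forall z t, sqrt (x * x + y * y) + Rabs z < 1 ->
    den c s (x + z * cos t) (y + z * sin t) <> 0).
  { intros z t Hz. apply Rgt_not_eq, den_pos. now apply in_unit_disc. }
  set (L := fun z t => 2 * (ker_re c s (x + z * cos t) (y + z * sin t) * cos t
    - ker_im c s (x + z * cos t) (y + z * sin t) * sin t)).
  assert (CL : forall z t, sqrt (x * x + y * y) + Rabs z < 1 ->
    continuous (fun q : R * R => L (fst q) (snd q)) (z, t)).
  { intros z t Hz. unfold L. apply continuous_Rmult; [cont|].
    apply continuous_Rminus; apply continuous_Rmult; try cont.
    - apply (continuous_ker_re (fun _ => c) (fun _ => s)
        (fun q : R * R => x + fst q * cos (snd q)) (fun q : R * R => y + fst q * sin (snd q)));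
        try cont. now apply Hden.
    - apply (continuous_ker_im (fun _ => c) (fun _ => s)
        (fun q : R * R => x + fst q * cos (snd q)) (fun q : R * R => y + fst q * sin (snd q)));
        try cont. now apply Hden. }
  assert (CLt : forall z t, sqrt (x * x + y * y) + Rabs z < 1 -> continuous (L z) t).
  { intros z t Hz. apply (continuous_comp (fun t => (z, t)) (fun q => L (fst q) (snd q)));
      [cont | now apply CL]. }
  assert (Hz : forall z, 0 <= z <= r -> sqrt (x * x + y * y) + Rabs z < 1)
    by (intros z Hz; rewrite Rabs_pos_eq; lra).
  assert (Hloc : forall z, 0 <= z <= r ->
    locally z (fun z => sqrt (x * x + y * y) + Rabs z < 1)).
  { intros z Hz'. assert (Hp : 0 < 1 - sqrt (x * x + y * y) - Rabs z)
      by (specialize (Hz z Hz'); lra).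
    exists (mkposreal _ Hp). intros z' Hz''.
    change (Rabs (z' - z) < 1 - sqrt (x * x + y * y) - Rabs z) in Hz''.
    assert (H1 := Rabs_triang_inv z' z). lra. }
  assert (E : is_RInt (fun z => RInt (L z) 0 (2 * PI)) 0 r
    (minus (circ (poisson c s) one x y r) (circ (poisson c s) one x y 0))).
  { apply (is_RInt_derive (V := R_CompleteNormedModule) (fun z => circ (poisson c s) one x y z));
      rewrite Rmin_left, Rmax_right by exact Hr; intros z Hz'.
    - unfold circ. apply (is_derive_RInt_param_cont
        (fun z t => poisson c s (x + z * cos t) (y + z * sin t) * one t) L).
      + apply two_PI_pos.
      + generalize (Hloc z Hz'). apply filter_imp. intros z' Hz'' t _.
        apply (is_derive_ext (fun z => poisson c s (x + z * cos t) (y + z * sin t))).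
        * intros u. symmetry. apply Rmult_1_r.
        * apply (poisson_derive c s (fun z => x + z * cos t) (fun z => y + z * sin t));
            [auto_derive; [exact I | ring] .. | now apply Hden].
      + generalize (Hloc z Hz'). apply filter_imp. intros z' Hz''. apply ex_RInt_cont.
        intros t. apply continuous_Rmult; [|apply cont_one].
        apply (continuous_poisson (fun _ => c) (fun _ => s)
          (fun t => x + z' * cos t) (fun t => y + z' * sin t)); try cont. now apply Hden.
      + intros t _. now apply CLt, Hz.
      + intros t _. now apply CL, Hz.
    - apply (continuous_RInt_param_loc L).
      + apply two_PI_pos.
      + generalize (Hloc z Hz'). apply filter_imp. intros z' Hz''. apply ex_RInt_cont.
        intros t. now apply CLt.
      + intros t _. now apply CL, Hz. }
  apply is_RInt_unique in E.
  rewrite (RInt_Rext _ (fun _ => 0)) in E; [|exact Hr|].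
  - rewrite RInt_Rconst in E. unfold minus, plus, opp in E. simpl in E. lra.
  - intros z Hz'. assert (Hz1 := Hz z ltac:(lra)).
    assert (EQ := FTC (fun t => poisson_conj c s (x + z * cos t) (y + z * sin t))
      (fun t => z * L z t) 0 (2 * PI)).
    rewrite RInt_Rmult in EQ by (apply ex_RInt_cont; intros; now apply CLt).
    cbv beta in EQ. rewrite cos_2PI, sin_2PI, cos_0, sin_0, Rminus_diag in EQ.
    apply (Rmult_eq_reg_l z); [|lra]. rewrite Rmult_0_r. apply EQ.
    + intros t. unfold L.
      eapply (eq_rect _ (fun l => is_derive _ t l)).
      * apply (poisson_conj_derive c s (fun t => x + z * cos t) (fun t => y + z * sin t) t
          (- z * sin t) (z * cos t)); [auto_derive; [exact I | ring] .. | now apply Hden].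
      * simpl. ring.
    + intros t. apply continuous_Rmult; [cont | now apply CLt].
Qed.

(** There is no factor [1 / (2 PI)]: the Poisson integral of 1 is [2 PI], matching the normalisation
    of [circ]. *)
Definition kernel_int (k : R -> R -> R -> R -> R) (v : R -> R) (x y : R) : R :=
  RInt (fun t => k (cos t) (sin t) x y * v t) 0 (2 * PI).

Notation poisson_int := (kernel_int poisson).

Lemma ex_poisson_int (u : R -> R) (x y : R) :
  (forall t, continuous u t) -> x * x + y * y < 1 ->
  ex_RInt (fun th => poisson (cos th) (sin th) x y * u th) 0 (2 * PI).
Proof.
  intros Hu H. apply ex_RInt_cont. intros t. apply continuous_Rmult; [|apply Hu].
  apply (continuous_poisson (fun t => cos t) (fun t => sin t) (fun _ => x) (fun _ => y));
    try cont. now apply Rgt_not_eq, den_pos.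
Qed.

Lemma continuous_poisson_int {T : UniformSpace} (u : R -> R) (X Y : T -> R) (p : T) :
  (forall t, continuous u t) -> X p * X p + Y p * Y p < 1 ->
  continuous X p -> continuous Y p ->
  continuous (fun q => poisson_int u (X q) (Y q)) p.
Proof.
  intros Hu H HX HY. unfold kernel_int.
  apply (continuous_RInt_param_loc (fun q th => poisson (cos th) (sin th) (X q) (Y q) * u th)).
  - apply two_PI_pos.
  - assert (C : continuous (fun q => X q * X q + Y q * Y q) p) by cont.
    assert (Hp : 0 < 1 - (X p * X p + Y p * Y p)) by lra.
    generalize (proj1 (filterlim_locally _ _) C (mkposreal _ Hp)). apply filter_imp.
    intros q Hq. change (Rabs (X q * X q + Y q * Y q - (X p * X p + Y p * Y p))
      < 1 - (X p * X p + Y p * Y p)) in Hq.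
    apply ex_poisson_int; [exact Hu|]. apply Rabs_lt_between in Hq. lra.
  - intros t _.
    assert (H1 : forall h : T -> R, continuous h p ->
       continuous (fun q : T * R => h (fst q)) (p, t)).
    { intros h Hh. apply (continuous_comp fst h); [apply continuous_fst | exact Hh]. }
    apply continuous_Rmult; [|cont].
    apply (continuous_poisson (fun q : T * R => cos (snd q)) (fun q => sin (snd q))
      (fun q => X (fst q)) (fun q => Y (fst q))); try cont.
    + now apply H1.
    + now apply H1.
    + now apply Rgt_not_eq, den_pos.
Qed.

Lemma poisson_int_mvp (u : R -> R) (k x y r : R) :
  (forall t, continuous u t) -> 0 <= k < 1 -> 0 <= r -> sqrt (x * x + y * y) + r < 1 ->
  circ (fun x y => poisson_int u (k * x) (k * y)) one x y r
    = 2 * PI * poisson_int u (k * x) (k * y).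
Proof.
  intros Hu Hk Hr H.
  assert (Hs : sqrt (k * x * (k * x) + k * y * (k * y)) = k * sqrt (x * x + y * y)).
  { replace (k * x * (k * x) + k * y * (k * y)) with ((k * k) * (x * x + y * y)) by ring.
    rewrite sqrt_mult, sqrt_square by nra. reflexivity. }
  assert (Hp := sqrt_pos (x * x + y * y)).
  assert (Hk1 : sqrt (k * x * (k * x) + k * y * (k * y)) + k * r < 1) by (rewrite Hs; nra).
  assert (Hin : forall t, (k * x + k * r * cos t) * (k * x + k * r * cos t)
    + (k * y + k * r * sin t) * (k * y + k * r * sin t) < 1).
  { intros t. apply in_unit_disc. rewrite (Rabs_pos_eq (k * r)) by nra. exact Hk1. }
  unfold circ, one, kernel_int.
  rewrite (RInt_Rext _ (fun t => RInt (fun th => poisson (cos th) (sin th)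
    (k * x + k * r * cos t) (k * y + k * r * sin t) * u th) 0 (2 * PI))).
  - rewrite (Fubini (fun t th => poisson (cos th) (sin th)
      (k * x + k * r * cos t) (k * y + k * r * sin t) * u th)).
    + rewrite <- RInt_Rmult.
      * apply RInt_Rext; [apply two_PI_pos|]. intros th _.
        rewrite (RInt_Rext _ (fun t => u th * (poisson (cos th) (sin th)
          (k * x + k * r * cos t) (k * y + k * r * sin t) * one t))).
        -- rewrite RInt_Rmult.
           ++ fold (circ (poisson (cos th) (sin th)) one (k * x) (k * y) (k * r)).
              rewrite poisson_mvp; [eqR; ring | nra | exact Hk1].
           ++ apply ex_RInt_cont. intros t. apply continuous_Rmult; [|apply cont_one].
              apply (continuous_poisson (fun _ => cos th) (fun _ => sin th)
                (fun t => k * x + k * r * cos t) (fun t => k * y + k * r * sin t)); try cont.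
              apply Rgt_not_eq, den_pos, Hin.
        -- apply two_PI_pos.
        -- intros t _. unfold one. ring.
      * apply ex_poisson_int; [exact Hu|].
        (* The centre is the midpoint of two antipodal points of a circle inside the disc, hence in
           the disc too. *)
        assert (E := Hin 0). assert (F := Hin PI). rewrite cos_0, sin_0 in E.
        rewrite cos_PI, sin_PI in F. nra.
    + apply two_PI_pos.
    + intros [t th]. apply continuous_Rmult; [|cont].
      apply (continuous_poisson (fun q : R * R => cos (snd q)) (fun q => sin (snd q))
        (fun q => k * x + k * r * cos (fst q)) (fun q => k * y + k * r * sin (fst q))); try cont.
      apply Rgt_not_eq, den_pos, Hin.
  - apply two_PI_pos.
  - intros t _. rewrite Rmult_1_r. apply RInt_Rext; [apply two_PI_pos|].
    intros th _. f_equal. f_equal; ring.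
Qed.

(** This form shows the symmetry in [a] and [b], and bounds the denominator below by a multiple of
    [1 - cos (a - b)]. *)
Lemma den_polar (a b k : R) :
  den (cos a) (sin a) (k * cos b) (k * sin b)
    = (1 - k) * (1 - k) + 2 * k * (1 - cos (a - b)).
Proof.
  unfold den. rewrite cos_minus.
  assert (Ha := sin2_cos2 a). assert (Hb := sin2_cos2 b). unfold Rsqr in *.
  transitivity ((sin a * sin a + cos a * cos a) + k * k * (sin b * sin b + cos b * cos b)
    - 2 * k * (cos a * cos b + sin a * sin b)); [ring|]. rewrite Ha, Hb. ring.
Qed.

Lemma poisson_polar (a b k : R) :
  poisson (cos a) (sin a) (k * cos b) (k * sin b)
    = (1 - k * k) / ((1 - k) * (1 - k) + 2 * k * (1 - cos (a - b))).
Proof.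
  unfold poisson. rewrite den_polar. f_equal.
  assert (Ha := sin2_cos2 a). assert (Hb := sin2_cos2 b). unfold Rsqr in *.
  transitivity ((sin a * sin a + cos a * cos a) - k * k * (sin b * sin b + cos b * cos b));
    [ring|]. rewrite Ha, Hb. ring.
Qed.

Lemma cos_sin_scaled (k b : R) :
  0 <= k < 1 -> k * cos b * (k * cos b) + k * sin b * (k * sin b) < 1.
Proof.
  intros Hk. assert (Hb := sin2_cos2 b). unfold Rsqr in *.
  replace (_ + _) with (k * k * (sin b * sin b + cos b * cos b)) by ring. rewrite Hb. nra.
Qed.

(** The kernel depends only on [k] and [cos (t - b)], so boundary angle and interior angle can be
    exchanged. The integral becomes the mean over the circle of radius [k] about 0 of one fixed
    kernel. *)
Lemma poisson_int_1 (b k : R) :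
  0 <= k < 1 -> poisson_int one (k * cos b) (k * sin b) = 2 * PI.
Proof.
  intros Hk. unfold kernel_int.
  transitivity (circ (poisson (cos b) (sin b)) one 0 0 k).
  - unfold circ. apply RInt_Rext; [apply two_PI_pos|]. intros t _.
    rewrite !Rplus_0_l, !poisson_polar.
    replace (b - t) with (- (t - b)) by ring. now rewrite cos_neg.
  - rewrite poisson_mvp.
    + unfold poisson, den. assert (Hb := sin2_cos2 b). unfold Rsqr in Hb.
      rewrite !Rmult_0_l, !Rminus_0_r, (Rplus_comm (cos b * cos b)), Hb. field.
    + lra.
    + rewrite !Rmult_0_l, Rplus_0_r, sqrt_0. lra.
Qed.

(* A modulus of continuity in the form that can be integrated against the
   Poisson kernel without splitting the circle. *)
Lemma oscillation (u : R -> R) (e : R) :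
  (forall t, continuous u t) -> (forall t, u (t + 2 * PI) = u t) -> 0 < e ->
  exists K, 0 <= K /\ forall a b, 0 <= a <= 2 * PI -> 0 <= b <= 2 * PI ->
    Rabs (u a - u b) <= e + K * (1 - cos (a - b)).
Proof.
  intros Hu Hper He. assert (HPI := PI_RGT_0).
  destruct (tube (fun q t => u (t + q)) 0 (2 * PI) 0) with (eps := mkposreal e He) as [d0 Hd0].
  { intros t _. cont. }
  set (d := Rmin d0 (PI / 2)).
  assert (Hd : 0 < d <= PI / 2 /\ d <= d0).
  { unfold d. assert (H := cond_pos d0). unfold Rmin. destruct Rle_dec; lra. }
  assert (Hclose : forall a q, 0 <= a <= 2 * PI -> Rabs q < d -> Rabs (u (a + q) - u a) < e).
  { intros a q Ha Hq. assert (B : ball 0 d0 q) by (change (Rabs (q - 0) < d0);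
      rewrite Rminus_0_r; lra).
    assert (H := Hd0 q B a Ha). simpl in H. now rewrite Rplus_0_r in H. }
  destruct (continuity_ab_maj (fun t => Rabs (u t)) 0 (2 * PI) two_PI_pos) as [m [Hm _]].
  { intros t _. apply continuity_pt_filterlim.
    apply (continuous_comp u Rabs); [apply Hu | apply continuous_Rabs]. }
  set (M := Rabs (u m)) in *.
  assert (Hcd : 0 < 1 - cos d).
  { assert (H := cos_decreasing_1 0 d ltac:(lra) ltac:(lra) ltac:(lra) ltac:(lra) ltac:(lra)).
    rewrite cos_0 in H. lra. }
  assert (HM : 0 <= M) by apply Rabs_pos.
  exists (2 * M / (1 - cos d)).
  assert (HK : 0 <= 2 * M / (1 - cos d)) by (apply Rdiv_le_0_compat; lra).
  split; [exact HK|].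
  assert (Hmain : forall a b, 0 <= a <= 2 * PI -> 0 <= b <= 2 * PI -> a <= b ->
    Rabs (u b - u a) <= e + 2 * M / (1 - cos d) * (1 - cos (b - a))).
  { intros a b Ha Hb Hab.
    assert (Hc1 := COS_bound (b - a)).
    destruct (Rlt_le_dec (b - a) d) as [H1|H1].
    - assert (H := Hclose a (b - a) Ha). rewrite Rabs_pos_eq in H by lra.
      replace (a + (b - a)) with b in H by ring. specialize (H H1). nra.
    (* Angles near opposite ends of [[0, 2 PI]] are close on the circle; periodicity moves [b] back
       by one turn. In the remaining range [cos (b - a) <= cos d], and the crude bound [2 M] is
       absorbed by the cosine term. *)
    - destruct (Rlt_le_dec (2 * PI - d) (b - a)) as [H2|H2].
      + assert (H := Hclose a (b - 2 * PI - a) Ha).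
        rewrite Rabs_left1 in H by lra.
        replace (a + (b - 2 * PI - a)) with (b - 2 * PI) in H by ring.
        rewrite <- (Hper (b - 2 * PI)) in H.
        replace (b - 2 * PI + 2 * PI) with b in H by ring.
        specialize (H ltac:(lra)). nra.
      + assert (Hc : cos (b - a) <= cos d).
        { destruct (Rle_dec (b - a) PI) as [H3|H3].
          - apply cos_decr_1; lra.
          - replace (b - a) with (- (2 * PI - (b - a)) + 2 * PI) by ring.
            rewrite cos_plus, sin_2PI, cos_2PI, cos_neg, Rmult_0_r, Rmult_1_r, Rminus_0_r.
            apply cos_decr_1; lra. }
        assert (HT : Rabs (u b - u a) <= 2 * M).
        { assert (A1 := Hm a Ha). assert (A2 := Hm b Hb).
          apply Rabs_le_between. apply Rabs_le_between in A1, A2. lra. }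
        assert (2 * M / (1 - cos d) * (1 - cos d) = 2 * M) by (field; lra).
        assert (2 * M / (1 - cos d) * (1 - cos d) <= 2 * M / (1 - cos d) * (1 - cos (b - a)))
          by (apply Rmult_le_compat_l; lra).
        lra. }
  intros a b Ha Hb. destruct (Rle_dec a b) as [H|H].
  - rewrite Rabs_minus_sym. replace (a - b) with (- (b - a)) by ring.
    rewrite cos_neg. now apply Hmain.
  - apply Hmain; lra.
Qed.

(** The kernel times [1 - cos (t - b)] is at most [2 (1 - k)]. Integrated against the kernel, the
    bound of [oscillation] leaves its constant term plus a quantity that tends to 0 as [k] tends to
    1, uniformly in [b]. *)
Lemma poisson_boundary (u : R -> R) (e : R) :
  (forall t, continuous u t) -> (forall t, u (t + 2 * PI) = u t) -> 0 < e ->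
  exists k0, k0 < 1 /\ forall k b, k0 < k < 1 -> 0 <= b <= 2 * PI ->
    Rabs (poisson_int u (k * cos b) (k * sin b) - 2 * PI * u b) <= e.
Proof.
  intros Hu Hper He. assert (HPI := PI_RGT_0).
  assert (He' : 0 < e / (4 * PI)) by (apply Rdiv_lt_0_compat; lra).
  destruct (oscillation u _ Hu Hper He') as (K & HK & Hosc).
  (* The error is at most [2 PI * e / (4 PI) + 4 PI K (1 - k)], and each term is at most [e / 2].
     [K + 1] avoids dividing by zero; [k > 1 / 2] gives [1 + k <= 4 k], needed for the kernel
     bound. *)
  exists (Rmax (1 / 2) (1 - e / (8 * PI * (K + 1)))).
  assert (HKP : 0 < 8 * PI * (K + 1)) by (apply Rmult_lt_0_compat; lra).
  assert (He2 : 0 < e / (8 * PI * (K + 1))) by (apply Rdiv_lt_0_compat; lra).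
  split; [unfold Rmax; destruct Rle_dec; lra|].
  intros k b Hk Hb.
  assert (Hk2 : 1 / 2 < k < 1 /\ (1 - k) < e / (8 * PI * (K + 1))).
  { revert Hk. unfold Rmax. destruct Rle_dec; lra. }
  clear Hk. destruct Hk2 as [Hk Hk'].
  assert (Hin := cos_sin_scaled k b ltac:(lra)).
  rewrite <- (poisson_int_1 b k) by lra. unfold kernel_int.
  rewrite (Rmult_comm _ (u b)), <- RInt_Rmult by (apply ex_poisson_int; [apply cont_one | exact Hin]).
  assert (Hker : forall t, 0 <= poisson (cos t) (sin t) (k * cos b) (k * sin b) /\
     poisson (cos t) (sin t) (k * cos b) (k * sin b) * (1 - cos (t - b)) <= 2 * (1 - k)).
  { intros t. rewrite poisson_polar. assert (Hc := COS_bound (t - b)).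
    assert (Hd : 0 < (1 - k) * (1 - k) + 2 * k * (1 - cos (t - b))) by nra.
    split; [apply Rdiv_le_0_compat; nra|].
    replace (_ / _ * _) with ((1 - k * k) * (1 - cos (t - b))
      / ((1 - k) * (1 - k) + 2 * k * (1 - cos (t - b)))) by (field; lra).
    apply Rle_div_l; [exact Hd|].
    assert ((1 + k) * (1 - cos (t - b))
      <= 2 * ((1 - k) * (1 - k) + 2 * k * (1 - cos (t - b)))) by nra.
    nra. }
  assert (Ex := ex_poisson_int u _ _ Hu Hin).
  assert (Ex1 := ex_poisson_int one _ _ cont_one Hin).
  assert (Ex1' := ex_RInt_Rmult (u b) _ _ _ Ex1).
  rewrite <- RInt_Rminus by assumption.
  assert (Exd := ex_RInt_Rminus _ _ _ _ Ex Ex1').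
  eapply Rle_trans; [apply abs_RInt_le; [apply two_PI_pos | exact Exd]|].
  eapply Rle_trans; [apply RInt_le with (g := fun t => e / (4 * PI) *
    (poisson (cos t) (sin t) (k * cos b) (k * sin b) * one t) + 2 * K * (1 - k))|].
  - apply two_PI_pos.
  - exact (ex_RInt_norm _ _ _ Exd).
  - apply ex_RInt_Rplus; [now apply ex_RInt_Rmult | apply ex_RInt_const].
  - intros t Ht. destruct (Hker t) as [K1 K2]. unfold one.
    set (P := poisson (cos t) (sin t) (k * cos b) (k * sin b)) in *.
    replace (P * u t - u b * (P * 1)) with (P * (u t - u b)) by ring.
    rewrite Rabs_mult, (Rabs_pos_eq P K1).
    assert (HO := Hosc t b ltac:(lra) Hb). nra.
  - rewrite (RInt_Rplus _ _ _ _ (ex_RInt_Rmult (e / (4 * PI)) _ _ _ Ex1) (ex_RInt_const _ _ _)).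
    rewrite RInt_Rmult, RInt_Rconst by assumption.
    fold (poisson_int one (k * cos b) (k * sin b)). rewrite poisson_int_1 by lra.
    replace (e / (4 * PI) * (2 * PI)) with (e / 2) by (field; lra).
    assert (E2 : e / (8 * PI * (K + 1)) * (8 * PI * (K + 1)) = e) by (field; split; lra).
    assert (HK' : (1 - k) * (8 * PI * (K + 1)) <= e).
    { rewrite <- E2 at 1. apply Rmult_le_compat_r; lra. }
    assert (0 <= (1 - k) * PI) by nra. nra.
Qed.

(** The Poisson integral is not usable on the unit circle itself, so [v] is compared with its dilate
    by [k < 1]. The difference inherits the mean value property and is small on the boundary, hence
    small inside by [max_principle]; then [k] tends to 1 at the fixed interior point. *)
Lemma poisson_representation (v : R -> R -> R) (x y : R) :
  cont2 v -> circle_mvp v -> x * x + y * y < 1 ->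
  poisson_int (fun t => v (cos t) (sin t)) x y = 2 * PI * v x y.
Proof.
  intros Hv Hm Hxy. set (u := fun t => v (cos t) (sin t)).
  assert (Hu : forall t, continuous u t) by (intros t; unfold u; cont).
  assert (Hper : forall t, u (t + 2 * PI) = u t).
  { intros t. unfold u. now rewrite cos_plus, sin_plus, cos_2PI, sin_2PI, !Rmult_0_r,
      !Rmult_1_r, Rminus_0_r, Rplus_0_r. }
  assert (Hmain : forall e, 0 < e -> exists k0, k0 < 1 /\ forall k, k0 < k < 1 ->
    Rabs (poisson_int u (k * x) (k * y) - 2 * PI * v x y) <= e).
  { intros e He. destruct (poisson_boundary u e Hu Hper He) as (k0 & Hk0 & Hb).
    exists (Rmax 0 k0). split; [unfold Rmax; destruct Rle_dec; lra|].
    intros k Hk.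
    assert (Hk' : 0 <= k < 1 /\ k0 < k) by (revert Hk; unfold Rmax; destruct Rle_dec; lra).
    destruct Hk' as [Hk1 Hk2].
    (* The maximum principle is one-sided; it is applied to the difference and to its negative. *)
    assert (Hsgn : forall sg, sg = 1 \/ sg = -1 ->
      sg * (poisson_int u (k * x) (k * y) - 2 * PI * v x y) <= e).
    { intros sg Hsg.
      assert (Hin : forall x y, x * x + y * y <= 1 -> k * x * (k * x) + k * y * (k * y) < 1).
      { intros x' y' H. replace (_ + _) with (k * k * (x' * x' + y' * y')) by ring. nra. }
      apply (max_principle (fun x y => sg * (poisson_int u (k * x) (k * y) - 2 * PI * v x y)) e).
      - intros x' y' H. apply continuous_Rmult; [cont|]. apply continuous_Rminus; [|cont].
        apply (continuous_poisson_int u (fun q : R * R => k * fst q) (fun q : R * R => k * snd q));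
          [exact Hu | now apply Hin | cont | cont].
      - intros x' y' H. destruct (Hm x' y' H) as (delta & Hd & Hmv).
        assert (Hs : sqrt (x' * x' + y' * y') < 1)
          by (rewrite <- sqrt_1; apply sqrt_lt_1_alt; nra).
        exists (Rmin delta (1 - sqrt (x' * x' + y' * y'))).
        split; [apply Rmin_pos; lra|]. intros r Hr.
        assert (Hr' : 0 < r < delta /\ sqrt (x' * x' + y' * y') + r < 1)
          by (revert Hr; unfold Rmin; destruct Rle_dec; lra).
        assert (Cone := cont_one).
        assert (Cp : forall t, continuous
          (fun t => poisson_int u (k * (x' + r * cos t)) (k * (y' + r * sin t))) t).
        { intros t. apply (continuous_poisson_int u (fun t => k * (x' + r * cos t))
            (fun t => k * (y' + r * sin t))); [exact Hu | | cont | cont].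
          apply Hin. left. apply in_unit_disc. rewrite Rabs_pos_eq; lra. }
        transitivity (sg * (circ (fun x y => poisson_int u (k * x) (k * y)) one x' y' r
          - 2 * PI * circ v one x' y' r)).
        + unfold circ. rewrite <- (RInt_Rmult (2 * PI)), <- RInt_Rminus, <- RInt_Rmult.
          * apply RInt_Rext; [apply two_PI_pos|]. intros t _. ring.
          * apply ex_RInt_cont. intros t. cont.
          * apply ex_RInt_cont. intros t. cont.
          * apply ex_RInt_cont. intros t. cont.
          * apply ex_RInt_cont. intros t. cont.
        + rewrite poisson_int_mvp by (auto; lra). rewrite Hmv by lra. ring.
      - intros t0.
        (* The boundary estimate holds for angles in [[0, 2 PI]], so [t0] is replaced by a
           representative there. *)
        destruct (unit_circle_angle (cos t0) (sin t0)) as (t & Ht & E1 & E2).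
        { assert (Hcs := sin2_cos2 t0). unfold Rsqr in Hcs. lra. }
        rewrite E1, E2. change (v (cos t) (sin t)) with (u t).
        assert (HB := Hb k t ltac:(lra) Ht). apply Rabs_le_between in HB.
        destruct Hsg as [-> | ->]; lra.
      - lra. }
    apply Rabs_le_between.
    assert (A1 := Hsgn 1 (or_introl eq_refl)). assert (A2 := Hsgn (-1) (or_intror eq_refl)). lra. }
  apply Rminus_diag_uniq. destruct (Req_dec (poisson_int u x y - 2 * PI * v x y) 0) as [E|E];
    [exact E | exfalso].
  set (D := Rabs (poisson_int u x y - 2 * PI * v x y)).
  assert (HD : 0 < D) by now apply Rabs_pos_lt.
  destruct (Hmain (D / 3) ltac:(lra)) as (k0 & Hk0 & Hk).
  assert (C : continuous (fun k => poisson_int u (k * x) (k * y)) 1).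
  { apply (continuous_poisson_int u (fun k => k * x) (fun k => k * y));
      [exact Hu | now rewrite !Rmult_1_l | cont | cont]. }
  assert (HD3 : 0 < D / 3) by lra.
  destruct (proj1 (filterlim_locally _ _) C (mkposreal _ HD3)) as [d Hd].
  (* Below 1, yet beyond both [k0] and [1 - d]: the two errors, each at most [D / 3], cannot add up
     to [D]. *)
  set (k := Rmax ((1 + k0) / 2) (1 - d / 2)).
  assert (Hkk : k0 < k < 1 /\ 1 - d < k).
  { assert (H := cond_pos d). unfold k, Rmax. destruct Rle_dec; lra. }
  assert (B : ball 1 d k) by (change (Rabs (k - 1) < d); rewrite Rabs_left; lra).
  assert (A1 := Hd k B). assert (A2 := Hk k ltac:(lra)).
  change (Rabs (poisson_int u (k * x) (k * y) - poisson_int u (1 * x) (1 * y)) < D / 3) in A1.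
  rewrite !Rmult_1_l in A1.
  assert (A3 : D <= Rabs (poisson_int u (k * x) (k * y) - poisson_int u x y)
    + Rabs (poisson_int u (k * x) (k * y) - 2 * PI * v x y)).
  { unfold D, Rabs. repeat destruct Rcase_abs; lra. }
  lra.
Qed.

(** * Taylor expansion of the kernels, uniform in the boundary point *)

Definition inv_re (c s x y : R) : R := (c - x) / den c s x y.
Definition inv_im (c s x y : R) : R := - (s - y) / den c s x y.

Lemma inv_complex (c s x y : R) :
  (inv_re c s x y, inv_im c s x y) = Cinv (Cminus (c, s) (x, y)).
Proof.
  unfold inv_re, inv_im, den, Cinv, Cminus, Cplus, Copp. simpl.
  rewrite !Rmult_1_r. reflexivity.
Qed.

Lemma ker_complex (c s x y : R) :
  den c s x y <> 0 ->
  (ker_re c s x y, ker_im c s x y)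
    = Cmult (c, s) (Cmult (inv_re c s x y, inv_im c s x y) (inv_re c s x y, inv_im c s x y)).
Proof.
  intros H. unfold ker_re, ker_im, inv_re, inv_im, Cmult. simpl.
  f_equal; field; exact H.
Qed.

Lemma poisson_complex (c s x y : R) :
  den c s x y <> 0 ->
  poisson c s x y = 2 * fst (Cmult (c, s) (inv_re c s x y, inv_im c s x y)) - 1.
Proof.
  intros H. unfold poisson, inv_re, inv_im, Cmult. simpl.
  unfold den in *. field. exact H.
Qed.

Lemma Rabs_fst_le (z : C) : Rabs (fst z) <= Cmod z.
Proof. eapply Rle_trans; [apply Rmax_l | apply Rmax_Cmod]. Qed.

Lemma Rabs_snd_le (z : C) : Rabs (snd z) <= Cmod z.
Proof. eapply Rle_trans; [apply Rmax_r | apply Rmax_Cmod]. Qed.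

Lemma Cmod_expi (t : R) : Cmod (cos t, sin t) = 1.
Proof.
  unfold Cmod. simpl. rewrite !Rmult_1_r, Rplus_comm.
  assert (H := sin2_cos2 t). unfold Rsqr in H. rewrite H. apply sqrt_1.
Qed.

Section KernelExpansion.
Variables e z w : C.
Hypotheses (He : Cmod e = 1) (Hz : Cmod z < 1) (Hw : Cmod w <= (1 - Cmod z) / 2).

(** Since [w] is at most half the distance from [z] to the unit circle, [k] bounds both [m] and
    [m'], whatever [e] on the circle. *)
Let k := 2 / (1 - Cmod z).
Let m := Cinv (e - z)%C.
Let m' := Cinv (e - (z + w))%C.

Lemma Cmod_e_minus : 1 - Cmod z <= Cmod (e - z)%C.
Proof.
  assert (H := Cmod_triangle (e - z)%C z).
  replace ((e - z) + z)%C with e in H by ring. lra.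
Qed.

Lemma Cmod_e_minus' : (1 - Cmod z) / 2 <= Cmod (e - (z + w))%C.
Proof.
  assert (H := Cmod_triangle (e - (z + w))%C (z + w)%C).
  assert (H' := Cmod_triangle z w).
  replace ((e - (z + w)) + (z + w))%C with e in H by ring. lra.
Qed.

Lemma e_minus_neq : (e - z)%C <> 0.
Proof. apply Cmod_gt_0. assert (H := Cmod_e_minus). lra. Qed.

Lemma e_minus_neq' : (e - (z + w))%C <> 0.
Proof. apply Cmod_gt_0. assert (H := Cmod_e_minus'). lra. Qed.

Lemma Cmod_m : Cmod m <= k.
Proof.
  unfold m, k. rewrite Cmod_inv by exact e_minus_neq.
  replace (2 / (1 - Cmod z)) with (/ ((1 - Cmod z) / 2)) by (field; lra).
  assert (H := Cmod_e_minus). apply Rinv_le_contravar; lra.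
Qed.

Lemma Cmod_m' : Cmod m' <= k.
Proof.
  unfold m', k. rewrite Cmod_inv by exact e_minus_neq'.
  replace (2 / (1 - Cmod z)) with (/ ((1 - Cmod z) / 2)) by (field; lra).
  assert (H := Cmod_e_minus'). apply Rinv_le_contravar; lra.
Qed.

(** From [m' - m = w m m'] the remainder is exactly [e w^2 m^2 m']. *)
Lemma expand_inv :
  Cmod (e * m' - e * m - w * (e * (m * m)))%C <= k * k * k * (Cmod w * Cmod w).
Proof.
  replace (e * m' - e * m - w * (e * (m * m)))%C with (e * (w * w) * (m * m * m'))%C.
  - rewrite !Cmod_mult, He, Rmult_1_l, Rmult_comm.
    assert (H := Cmod_m). assert (H' := Cmod_m').
    assert (P := Cmod_ge_0 m). assert (P' := Cmod_ge_0 m'). assert (Pw := Cmod_ge_0 w).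
    apply Rmult_le_compat_r; [nra|].
    apply Rmult_le_compat; nra.
  - unfold m, m'. field. split; [exact e_minus_neq | exact e_minus_neq'].
Qed.

(** Here the remainder factors as [e w^2 m^2 m' (m' + 2 m)], whence the constant 3. *)
Lemma expand_inv2 :
  Cmod (e * (m' * m') - e * (m * m) - w * (2 * (e * (m * m) * m)))%C
    <= 3 * (k * k * k * k) * (Cmod w * Cmod w).
Proof.
  replace (e * (m' * m') - e * (m * m) - w * (2 * (e * (m * m) * m)))%C
    with (e * (w * w) * ((m * m * m') * (m' + 2 * m)))%C.
  - rewrite !Cmod_mult, He, Rmult_1_l, Rmult_comm.
    assert (H := Cmod_m). assert (H' := Cmod_m').
    assert (P := Cmod_ge_0 m). assert (P' := Cmod_ge_0 m'). assert (Pw := Cmod_ge_0 w).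
    assert (T := Cmod_triangle m' (2 * m)%C).
    rewrite Cmod_mult, Cmod_R, (Rabs_pos_eq 2) in T by lra.
    assert (P2 := Cmod_ge_0 (m' + 2 * m)%C).
    apply Rmult_le_compat_r; [nra|].
    replace (3 * (k * k * k * k)) with ((k * k * k) * (3 * k)) by ring.
    apply Rmult_le_compat; [apply Rmult_le_pos; nra | exact P2 | | lra].
    apply Rmult_le_compat; nra.
  - unfold m, m'. field. split; [exact e_minus_neq | exact e_minus_neq'].
Qed.
End KernelExpansion.

(** Real part of [2 e / (e - z)^3], the [z]-derivative of the kernel [e / (e - z)^2]; [ker3_im] is
    the imaginary part. *)
Definition ker3_re (c s x y : R) : R :=
  2 * (ker_re c s x y * inv_re c s x y - ker_im c s x y * inv_im c s x y).
Definition ker3_im (c s x y : R) : R :=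
  2 * (ker_re c s x y * inv_im c s x y + ker_im c s x y * inv_re c s x y).

Lemma Cmod_pair (x y : R) : Cmod (x, y) = sqrt (x * x + y * y).
Proof. unfold Cmod. simpl. now rewrite !Rmult_1_r. Qed.

Lemma Cmod_pair_sqr (x y : R) : Cmod (x, y) * Cmod (x, y) = x * x + y * y.
Proof. rewrite Cmod_pair. apply sqrt_sqrt. nra. Qed.

Lemma kernel_expansion (x y : R) :
  x * x + y * y < 1 -> exists K d, 0 < d /\ forall h l, Cmod (h, l) <= d ->
    (x + h) * (x + h) + (y + l) * (y + l) < 1 /\
    forall t,
    Rabs (poisson (cos t) (sin t) (x + h) (y + l) - poisson (cos t) (sin t) x y
      - (h * (2 * ker_re (cos t) (sin t) x y) + l * (- 2 * ker_im (cos t) (sin t) x y)))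
      <= K * (h * h + l * l) /\
    Rabs (ker_re (cos t) (sin t) (x + h) (y + l) - ker_re (cos t) (sin t) x y
      - (h * ker3_re (cos t) (sin t) x y + l * - ker3_im (cos t) (sin t) x y))
      <= K * (h * h + l * l) /\
    Rabs (ker_im (cos t) (sin t) (x + h) (y + l) - ker_im (cos t) (sin t) x y
      - (h * ker3_im (cos t) (sin t) x y + l * ker3_re (cos t) (sin t) x y))
      <= K * (h * h + l * l).
Proof.
  intros Hxy.
  assert (Hz : Cmod (x, y) < 1).
  { rewrite Cmod_pair, <- sqrt_1. apply sqrt_lt_1_alt. nra. }
  set (k := 2 / (1 - Cmod (x, y))).
  assert (Hk : 0 < k) by (apply Rdiv_lt_0_compat; lra).
  (* One constant serves all three bounds: the first is doubled because the Poisson kernel is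
     [2 Re (e / (e - z)) - 1]. *)
  exists (2 * (k * k * k) + 3 * (k * k * k * k)), ((1 - Cmod (x, y)) / 2).
  split; [lra|]. intros h l Hw.
  assert (Hxy' : (x + h) * (x + h) + (y + l) * (y + l) < 1).
  { rewrite <- Cmod_pair_sqr.
    assert (T := Cmod_triangle (x, y) (h, l)).
    change (Cplus (x, y) (h, l)) with (x + h, y + l) in T.
    assert (P := Cmod_ge_0 (x + h, y + l)). assert (P0 := Cmod_ge_0 (x, y)). nra. }
  split; [exact Hxy'|]. intros t.
  assert (D := Rgt_not_eq _ _ (den_pos t x y Hxy)).
  assert (D' := Rgt_not_eq _ _ (den_pos t _ _ Hxy')).
  assert (E1 := expand_inv (cos t, sin t) (x, y) (h, l) (Cmod_expi t) Hz Hw).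
  assert (E2 := expand_inv2 (cos t, sin t) (x, y) (h, l) (Cmod_expi t) Hz Hw).
  fold k in E1, E2. cbv beta zeta in E1, E2.
  change (Cplus (x, y) (h, l)) with (x + h, y + l) in E1, E2.
  rewrite <- !inv_complex in E1, E2.
  rewrite <- (ker_complex _ _ _ _ D) in E1, E2. rewrite <- (ker_complex _ _ _ _ D') in E2.
  rewrite Cmod_pair_sqr in E1, E2.
  assert (Hn : 0 <= h * h + l * l) by nra.
  assert (Hk2 : 0 < k * k) by now apply Rmult_lt_0_compat.
  assert (Hk3 : 0 < k * k * k) by now apply Rmult_lt_0_compat.
  assert (Hk4 : 0 < k * k * k * k) by now apply Rmult_lt_0_compat.
  rewrite !poisson_complex by assumption.
  split; [|split].
  - assert (F := Rle_trans _ _ _ (Rabs_fst_le _) E1). simpl in F.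
    match type of F with Rabs ?X <= _ => set (A := X) in F end.
    match goal with |- Rabs ?Y <= _ => replace Y with (2 * A) by (unfold A; simpl; ring) end.
    rewrite Rabs_mult, (Rabs_pos_eq 2) by lra. nra.
  - assert (F := Rle_trans _ _ _ (Rabs_fst_le _) E2). simpl in F.
    eapply Rle_trans; [|apply Rle_trans with (1 := F); nra].
    right. f_equal. unfold ker3_re, ker3_im. ring.
  - assert (F := Rle_trans _ _ _ (Rabs_snd_le _) E2). simpl in F.
    eapply Rle_trans; [|apply Rle_trans with (1 := F); nra].
    right. f_equal. unfold ker3_re, ker3_im. ring.
Qed.

(** Differentiability with a quadratic remainder. This quantitative form passes through integrals
    over the boundary angle and over small circles. The sign of [K] is left free. *)
Definition expands (v : R -> R -> R) (x y a b : R) : Prop :=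
  exists K d, 0 < d /\ forall h l, Cmod (h, l) <= d ->
    Rabs (v (x + h) (y + l) - v x y - (h * a + l * b)) <= K * (h * h + l * l).

Lemma kernel_int_expand (K0 K1 A B u : R -> R) (h l E M : R) :
  (forall t, continuous K0 t) -> (forall t, continuous K1 t) ->
  (forall t, continuous A t) -> (forall t, continuous B t) ->
  (forall t, continuous u t) ->
  (forall t, 0 <= t <= 2 * PI -> Rabs (u t) <= M) ->
  (forall t, Rabs (K1 t - K0 t - (h * A t + l * B t)) <= E) ->
  Rabs (RInt (fun t => K1 t * u t) 0 (2 * PI) - RInt (fun t => K0 t * u t) 0 (2 * PI)
    - (h * RInt (fun t => A t * u t) 0 (2 * PI) + l * RInt (fun t => B t * u t) 0 (2 * PI)))
  <= 2 * PI * (E * M).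
Proof.
  intros C0 C1 CA CB Cu HM HE.
  assert (I0 : ex_RInt (fun t => K0 t * u t) 0 (2 * PI)) by (apply ex_RInt_cont; intros; cont).
  assert (I1 : ex_RInt (fun t => K1 t * u t) 0 (2 * PI)) by (apply ex_RInt_cont; intros; cont).
  assert (IA : ex_RInt (fun t => A t * u t) 0 (2 * PI)) by (apply ex_RInt_cont; intros; cont).
  assert (IB : ex_RInt (fun t => B t * u t) 0 (2 * PI)) by (apply ex_RInt_cont; intros; cont).
  rewrite <- (RInt_Rmult h _ _ _ IA), <- (RInt_Rmult l _ _ _ IB).
  rewrite <- (RInt_Rplus _ _ _ _ (ex_RInt_Rmult h _ _ _ IA) (ex_RInt_Rmult l _ _ _ IB)).
  rewrite <- (RInt_Rminus _ _ _ _ I1 I0).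
  eapply Rle_trans; [apply RInt_close|].
  - apply two_PI_pos.
  - now apply ex_RInt_Rminus.
  - apply ex_RInt_Rplus; now apply ex_RInt_Rmult.
  - intros t Ht.
    replace (K1 t * u t - K0 t * u t - (h * (A t * u t) + l * (B t * u t)))
      with ((K1 t - K0 t - (h * A t + l * B t)) * u t) by ring.
    rewrite Rabs_mult. apply Rmult_le_compat; [apply Rabs_pos | apply Rabs_pos | apply HE | now apply HM].
  - right. eqR. ring.
Qed.

(** * Divergence at a point from fluxes through shrinking circles *)

(** Against [cos] or [sin], the constant term and the mixed term integrate to zero, and the squared
    term contributes [PI]. *)
Lemma circ_expand (v : R -> R -> R) (x y a b : R) :
  cont2 v -> expands v x y a b ->
  exists K d, 0 < d /\ forall r, 0 < r <= d ->
    Rabs (circ v cos x y r - PI * a * r) <= K * (r * r) /\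
    Rabs (circ v sin x y r - PI * b * r) <= K * (r * r).
Proof.
  intros Hv (K & d & Hd & HK). exists (2 * PI * K), d. split; [exact Hd|].
  intros r Hr.
  assert (HK' : forall t, Rabs (v (x + r * cos t) (y + r * sin t)
     - (v x y + (r * cos t * a + r * sin t * b))) <= K * (r * r)).
  { intros t. assert (Hcs := sin2_cos2 t). unfold Rsqr in Hcs.
    assert (HN : r * cos t * (r * cos t) + r * sin t * (r * sin t) = r * r).
    { replace (_ + _) with (r * r * (sin t * sin t + cos t * cos t)) by ring.
      rewrite Hcs. ring. }
    rewrite <- HN.
    replace (_ - _) with (v (x + r * cos t) (y + r * sin t) - v x y
      - (r * cos t * a + r * sin t * b)) by ring.
    apply HK. rewrite Cmod_pair, HN, sqrt_square; lra. }
  assert (Hb : forall k t, Rabs (k t) <= 1 ->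
    Rabs (v (x + r * cos t) (y + r * sin t) * k t
     - (v x y + (r * cos t * a + r * sin t * b)) * k t) <= K * (r * r)).
  { intros k t Hk. rewrite <- Rmult_minus_distr_r, Rabs_mult.
    specialize (HK' t). set (A := Rabs (_ - _)) in *.
    assert (HA : 0 <= A) by apply Rabs_pos. assert (HB := Rabs_pos (k t)). nra. }
  assert (H2PI := two_PI_pos).
  replace (PI * a * r) with (RInt (fun t => (v x y + (r * cos t * a + r * sin t * b)) * cos t) 0 (2 * PI)).
  - replace (PI * b * r) with (RInt (fun t => (v x y + (r * cos t * a + r * sin t * b)) * sin t) 0 (2 * PI)).
    + unfold circ. split; (eapply Rle_trans;
        [apply RInt_close; [exact H2PI | apply ex_RInt_cont; intros; cont
           | apply ex_RInt_cont; intros; cont | intros t _; apply (Hb _ t)] | right; ring]).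
      * apply Rabs_le_between, COS_bound.
      * apply Rabs_le_between, SIN_bound.
    + rewrite (FTC (fun t => - v x y * cos t + r * a * (sin t * sin t) / 2
        + r * b * (t - sin t * cos t) / 2)).
      * rewrite cos_2PI, sin_2PI, cos_0, sin_0. eqR. field.
      * intros t. auto_derive; [exact I|].
        assert (Hcs := sin2_cos2 t). unfold Rsqr in Hcs.
        assert (Hm : r * b * (sin t * sin t + cos t * cos t) = r * b) by (rewrite Hcs; ring).
        eqR. lra.
      * intros t. cont.
  - rewrite (FTC (fun t => v x y * sin t + r * a * (t + sin t * cos t) / 2
        + r * b * (sin t * sin t) / 2)).
    + rewrite cos_2PI, sin_2PI, cos_0, sin_0. eqR. field.
    + intros t. auto_derive; [exact I|].
      assert (Hcs := sin2_cos2 t). unfold Rsqr in Hcs.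
      assert (Hm : r * a * (sin t * sin t + cos t * cos t) = r * a) by (rewrite Hcs; ring).
      eqR. lra.
    + intros t. cont.
Qed.

Lemma disc_average (g : R -> R -> R) (x y e : R) :
  cont2 g -> 0 < e -> exists d, 0 < d /\ forall r, 0 < r <= d ->
    Rabs (RInt (fun s => s * circ g one x y s) 0 r - PI * g x y * (r * r)) <= e * (r * r).
Proof.
  intros Hg He. assert (Cone := cont_one).
  assert (Cc : forall s, continuous (fun s => circ g one x y s) s).
  { intros s. apply (cont_circ g one (fun _ => x) (fun _ => y) (fun s => s)); cont. }
  destruct (proj1 (filterlim_locally _ _) (Cc 0) (mkposreal e He)) as [d Hd].
  exists (d / 2). assert (Hdp := cond_pos d). split; [lra|]. intros r Hr.
  replace (PI * g x y * (r * r)) with (RInt (fun s => s * (2 * PI * g x y)) 0 r).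
  - eapply Rle_trans; [apply (RInt_close _ _ 0 r (r * e))|].
    + lra.
    + apply ex_RInt_cont. intros s. cont.
    + apply ex_RInt_cont. intros s. cont.
    + intros s Hs. rewrite <- Rmult_minus_distr_l, Rabs_mult, (Rabs_pos_eq s) by lra.
      assert (B : ball 0 d s) by (change (Rabs (s - 0) < d); rewrite Rminus_0_r, Rabs_pos_eq; lra).
      assert (B' := Hd s B).
      change (Rabs (circ g one x y s - circ g one x y 0) < e) in B'. rewrite circ_0 in B'.
      apply Rmult_le_compat; [lra | apply Rabs_pos | lra | lra].
    + right. eqR. ring.
  - rewrite (FTC (fun s => PI * g x y * (s * s))).
    + eqR. ring.
    + intros s. auto_derive; [exact I | ring].
    + intros s. cont.
Qed.

(** To order [r^2] the left side of the flux law is [PI (a1 + b2) r^2], the right side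
    [- 2 PI * PI g r^2]. Derivatives are thus needed at the one point only, so a merely continuous
    [g] is allowed. *)
Lemma divergence_at_point (V1 V2 g : R -> R -> R) (x y a1 b1 a2 b2 d0 : R) :
  cont2 V1 -> cont2 V2 -> cont2 g ->
  expands V1 x y a1 b1 -> expands V2 x y a2 b2 -> 0 < d0 ->
  (forall r, 0 < r < d0 -> r * (circ V1 cos x y r + circ V2 sin x y r)
     = - 2 * PI * RInt (fun s => s * circ g one x y s) 0 r) ->
  a1 + b2 = - 2 * PI * g x y.
Proof.
  intros H1 H2 Hg E1 E2 Hd0 Hlaw. assert (HPI := PI_RGT_0).
  destruct (circ_expand _ _ _ _ _ H1 E1) as (K1 & d1 & Hd1 & B1).
  destruct (circ_expand _ _ _ _ _ H2 E2) as (K2 & d2 & Hd2 & B2).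
  apply Rminus_diag_uniq.
  destruct (Req_dec (a1 + b2 - - 2 * PI * g x y) 0) as [E|E]; [exact E | exfalso].
  set (X := a1 + b2 - - 2 * PI * g x y) in *.
  assert (HX : 0 < Rabs X) by now apply Rabs_pos_lt.
  (* Once [r (K1 + K2) <= e], the estimates give [PI |X| <= (1 + 2 PI) |X| / 8], which is
     impossible. *)
  set (e := Rabs X / 8).
  destruct (disc_average g x y e Hg ltac:(unfold e; lra)) as (d3 & Hd3 & B3).
  set (K := Rmax 1 (K1 + K2)).
  assert (HK : 1 <= K /\ K1 + K2 <= K) by (unfold K, Rmax; destruct Rle_dec; lra).
  set (r := Rmin (Rmin (d0 / 2) d1) (Rmin (Rmin d2 d3) (e / K))).
  assert (HeK : 0 < e / K) by (apply Rdiv_lt_0_compat; unfold e; lra).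
  assert (Hr : 0 < r < d0 /\ r <= d1 /\ r <= d2 /\ r <= d3 /\ r <= e / K).
  { unfold r, Rmin. repeat destruct Rle_dec; lra. }
  destruct Hr as (Hr0 & Hr1 & Hr2 & Hr3 & Hr4).
  destruct (B1 r ltac:(lra)) as [C1' _]. destruct (B2 r ltac:(lra)) as [_ C2'].
  assert (C3' := B3 r ltac:(lra)). specialize (Hlaw r Hr0).
  assert (HrK : r * K <= e).
  { replace e with (e / K * K) by (field; lra). apply Rmult_le_compat_r; lra. }
  set (A := circ V1 cos x y r) in *. set (B := circ V2 sin x y r) in *.
  set (I := RInt (fun s => s * circ g one x y s) 0 r) in *.
  assert (EQ : PI * X * (r * r) = - (r * (A - PI * a1 * r)) - r * (B - PI * b2 * r)
    - 2 * PI * (I - PI * g x y * (r * r))).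
  { unfold X. transitivity (PI * (a1 + b2 - - 2 * PI * g x y) * (r * r)
      + (- 2 * PI * I - r * (A + B))); [rewrite Hlaw; ring | ring]. }
  assert (EA : Rabs (PI * X * (r * r)) <= (r * (K1 + K2) + 2 * PI * e) * (r * r)).
  { rewrite EQ.
    apply Rabs_le_between in C1', C2', C3'.
    apply Rabs_le_between.
    assert (r * - (K1 * (r * r)) <= r * (A - PI * a1 * r) <= r * (K1 * (r * r)))
      by (split; apply Rmult_le_compat_l; lra).
    assert (r * - (K2 * (r * r)) <= r * (B - PI * b2 * r) <= r * (K2 * (r * r)))
      by (split; apply Rmult_le_compat_l; lra).
    assert (2 * PI * - (e * (r * r)) <= 2 * PI * (I - PI * g x y * (r * r)) <= 2 * PI * (e * (r * r)))
      by (split; apply Rmult_le_compat_l; lra).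
    lra. }
  rewrite Rabs_mult, Rabs_mult, (Rabs_pos_eq PI), (Rabs_pos_eq (r * r)) in EA by nra.
  apply Rmult_le_reg_r in EA; [|nra].
  assert (r * (K1 + K2) <= r * K) by (apply Rmult_le_compat_l; lra).
  assert (HP3 : 2 < PI) by (assert (Q := PI2_1); lra).
  unfold e in *. nra.
Qed.

Lemma circ_minus (k : R -> R) (g h : R -> R -> R) (x y s : R) :
  cont2 g -> cont2 h -> (forall t, continuous k t) ->
  circ (fun x y => g x y - h x y) k x y s = circ g k x y s - circ h k x y s.
Proof.
  intros Hg Hh Hk. unfold circ.
  rewrite <- RInt_Rminus by now apply ex_circ.
  apply RInt_Rext; [apply two_PI_pos|]. intros t _. ring.
Qed.

(** * Expansion of kernel integrals *)

Lemma continuous_bounded (v : R -> R) (a b : R) :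
  a <= b -> (forall t, continuous v t) ->
  exists M, 0 <= M /\ forall t, a <= t <= b -> Rabs (v t) <= M.
Proof.
  intros Hab Hv.
  destruct (continuity_ab_maj (fun t => Rabs (v t)) a b Hab) as [m [Hm _]].
  - intros t _. apply continuity_pt_filterlim.
    apply (continuous_comp v Rabs); [apply Hv | apply continuous_Rabs].
  - exists (Rabs (v m)). split; [apply Rabs_pos | exact Hm].
Qed.

Lemma kernels_continuous (x y : R) :
  x * x + y * y < 1 ->
  (forall t, continuous (fun t => poisson (cos t) (sin t) x y) t) /\
  (forall t, continuous (fun t => ker_re (cos t) (sin t) x y) t) /\
  (forall t, continuous (fun t => ker_im (cos t) (sin t) x y) t) /\
  (forall t, continuous (fun t => ker3_re (cos t) (sin t) x y) t) /\
  (forall t, continuous (fun t => ker3_im (cos t) (sin t) x y) t).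
Proof.
  intros H.
  assert (D : forall t, den (cos t) (sin t) x y <> 0)
    by (intros t; now apply Rgt_not_eq, den_pos).
  assert (Cr : forall t, continuous (fun t => ker_re (cos t) (sin t) x y) t).
  { intros t. apply (continuous_ker_re (fun t => cos t) (fun t => sin t)
      (fun _ => x) (fun _ => y)); [cont .. | apply D]. }
  assert (Ci : forall t, continuous (fun t => ker_im (cos t) (sin t) x y) t).
  { intros t. apply (continuous_ker_im (fun t => cos t) (fun t => sin t)
      (fun _ => x) (fun _ => y)); [cont .. | apply D]. }
  assert (Cmr : forall t, continuous (fun t => inv_re (cos t) (sin t) x y) t).
  { intros t. apply continuous_Rdiv; [cont | unfold den; cont | apply D]. }
  assert (Cmi : forall t, continuous (fun t => inv_im (cos t) (sin t) x y) t).
  { intros t. apply continuous_Rdiv; [cont | unfold den; cont | apply D]. }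
  split; [|split; [exact Cr | split; [exact Ci | split]]]; intros t.
  - apply (continuous_poisson (fun t => cos t) (fun t => sin t)
      (fun _ => x) (fun _ => y)); [cont .. | apply D].
  - unfold ker3_re. cont.
  - unfold ker3_im. cont.
Qed.

Lemma kernel_int_expands (v : R -> R) (x y : R) :
  (forall t, continuous v t) -> x * x + y * y < 1 ->
  expands (kernel_int poisson v) x y
    (2 * kernel_int ker_re v x y) (- 2 * kernel_int ker_im v x y) /\
  expands (kernel_int ker_re v) x y (kernel_int ker3_re v x y) (- kernel_int ker3_im v x y) /\
  expands (kernel_int ker_im v) x y (kernel_int ker3_im v x y) (kernel_int ker3_re v x y).
Proof.
  intros Hv Hxy.
  destruct (continuous_bounded v 0 (2 * PI) two_PI_pos Hv) as (N & HN & HB).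
  destruct (kernel_expansion x y Hxy) as (K & d & Hd & HK).
  destruct (kernels_continuous x y Hxy) as (Cp & Cr & Ci & C3r & C3i).
  assert (Hscal : forall c k, (forall t, continuous (fun t => k (cos t) (sin t) x y) t) ->
    c * kernel_int k v x y = RInt (fun t => (c * k (cos t) (sin t) x y) * v t) 0 (2 * PI)).
  { intros c k Hk. unfold kernel_int. rewrite <- RInt_Rmult.
    - apply RInt_Rext; [apply two_PI_pos|]. intros t _. ring.
    - apply ex_RInt_cont. intros t. apply continuous_Rmult; [apply Hk | apply Hv]. }
  rewrite (Hscal _ _ Cr), (Hscal _ _ Ci).
  replace (- kernel_int ker3_im v x y) with (-1 * kernel_int ker3_im v x y) by ring.
  rewrite (Hscal _ _ C3i).
  split; [|split]; exists (2 * PI * (K * N)), d; (split; [exact Hd|]); intros h l Hhl;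
    destruct (HK h l Hhl) as [Hin HE];
    destruct (kernels_continuous _ _ Hin) as (Cp' & Cr' & Ci' & _ & _);
    replace (2 * PI * (K * N) * (h * h + l * l)) with (2 * PI * ((K * (h * h + l * l)) * N)) by ring.
  - apply (kernel_int_expand (fun t => poisson (cos t) (sin t) x y)
      (fun t => poisson (cos t) (sin t) (x + h) (y + l))
      (fun t => 2 * ker_re (cos t) (sin t) x y) (fun t => - 2 * ker_im (cos t) (sin t) x y) v);
      try assumption; [intros t; cont .. | intros t; exact (proj1 (HE t))].
  - apply (kernel_int_expand (fun t => ker_re (cos t) (sin t) x y)
      (fun t => ker_re (cos t) (sin t) (x + h) (y + l))
      (fun t => ker3_re (cos t) (sin t) x y) (fun t => -1 * ker3_im (cos t) (sin t) x y) v);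
      try assumption; [intros t; cont | intros t].
    replace (-1 * ker3_im (cos t) (sin t) x y) with (- ker3_im (cos t) (sin t) x y) by ring.
    exact (proj1 (proj2 (HE t))).
  - apply (kernel_int_expand (fun t => ker_im (cos t) (sin t) x y)
      (fun t => ker_im (cos t) (sin t) (x + h) (y + l))
      (fun t => ker3_im (cos t) (sin t) x y) (fun t => ker3_re (cos t) (sin t) x y) v);
      try assumption. intros t. exact (proj2 (proj2 (HE t))).
Qed.

Lemma expands_ext (v w : R -> R -> R) (x y a b : R) :
  x * x + y * y < 1 ->
  (forall x y, x * x + y * y < 1 -> v x y = w x y) ->
  expands v x y a b -> expands w x y a b.
Proof.
  intros Hxy Hvw (K & d & Hd & HK).
  assert (Hs : Cmod (x, y) < 1).
  { rewrite Cmod_pair, <- sqrt_1. apply sqrt_lt_1_alt. nra. }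
  exists K, (Rmin d ((1 - Cmod (x, y)) / 2)). split; [apply Rmin_pos; lra|].
  intros h l Hhl.
  assert (Hhl' : Cmod (h, l) <= d /\ Cmod (h, l) <= (1 - Cmod (x, y)) / 2)
    by (revert Hhl; unfold Rmin; destruct Rle_dec; lra).
  rewrite <- !Hvw; [now apply HK | assumption |].
  rewrite <- Cmod_pair_sqr. assert (T := Cmod_triangle (x, y) (h, l)).
  change (Cplus (x, y) (h, l)) with (x + h, y + l) in T.
  assert (P := Cmod_ge_0 (x + h, y + l)). assert (P0 := Cmod_ge_0 (x, y)). nra.
Qed.

Lemma expands_scal (v : R -> R -> R) (x y a b c : R) :
  expands v x y a b -> expands (fun x y => c * v x y) x y (c * a) (c * b).
Proof.
  intros (K & d & Hd & HK). exists (Rabs c * K), d. split; [exact Hd|].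
  intros h l H. replace (_ - _ - _) with
    (c * (v (x + h) (y + l) - v x y - (h * a + l * b))) by ring.
  rewrite Rabs_mult, Rmult_assoc. apply Rmult_le_compat_l; [apply Rabs_pos | now apply HK].
Qed.

Lemma expands_plus (v w : R -> R -> R) (x y a b a' b' : R) :
  expands v x y a b -> expands w x y a' b' ->
  expands (fun x y => v x y + w x y) x y (a + a') (b + b').
Proof.
  intros (K & d & Hd & HK) (K' & d' & Hd' & HK').
  exists (K + K'), (Rmin d d'). split; [now apply Rmin_pos|]. intros h l H.
  assert (A := HK h l (Rle_trans _ _ _ H (Rmin_l _ _))).
  assert (B := HK' h l (Rle_trans _ _ _ H (Rmin_r _ _))).
  replace (_ - _ - _) with ((v (x + h) (y + l) - v x y - (h * a + l * b))
    + (w (x + h) (y + l) - w x y - (h * a' + l * b'))) by ring.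
  eapply Rle_trans; [apply Rabs_triang|]. lra.
Qed.

(** * From small circles to the Cauchy-Riemann equations *)

Lemma small_circle_in_box (x y r s t : R) :
  0 <= s <= r -> x * x + y * y + 3 * r <= 1 ->
  Rabs (x + s * cos t) <= 1 /\ Rabs (y + s * sin t) <= 1.
Proof.
  intros Hs H. assert (E := shrink_circle x y s t ltac:(lra) ltac:(lra)).
  clear Hs H. revert E. generalize (x + s * cos t), (y + s * sin t). intros X Y E.
  split; apply Rabs_le_between; nra.
Qed.

(** The conclusion is complex differentiability with derivative [a + i b]. It is read off a formula
    for [f1 + i f2] as a constant times the integral of [e / (e - z)^2] against boundary values of
    the potential. *)
Lemma small_circles_imply_differentiable (f1 f2 : R -> R -> R) (x y : R) :
  cont2 f1 -> cont2 f2 -> box_supp 2 f1 -> box_supp 2 f2 ->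
  (forall x y, x * x + y * y < 1 -> exists delta, 0 < delta /\ forall r, 0 < r < delta ->
     circ f1 cos x y r - circ f2 sin x y r = 0 /\
     circ f1 sin x y r + circ f2 cos x y r = 0) ->
  x * x + y * y < 1 ->
  exists a b, expands f1 x y a (- b) /\ expands f2 x y b a.
Proof.
  intros H1 H2 S1 S2 HJ Hxy. assert (HPI := PI_RGT_0).
  assert (Ccos := continuous_cos). assert (Csin := continuous_sin).
  assert (P1c := cont2_pot f1 cos H1 Ccos). assert (P1s := cont2_pot f1 sin H1 Csin).
  assert (P2c := cont2_pot f2 cos H2 Ccos). assert (P2s := cont2_pot f2 sin H2 Csin).
  (* [u1] and [u2] are the real and imaginary parts of the potential of [f1 + i f2], the angular
     weight being [e^(it)]. *)
  set (u1 := fun x y => pot f1 cos x y - pot f2 sin x y).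
  set (u2 := fun x y => pot f1 sin x y + pot f2 cos x y).
  assert (U1 : cont2 u1) by now apply cont2_minus.
  assert (U2 : cont2 u2) by now apply cont2_plus.
  assert (Cone := cont_one).
  assert (Hlaw : forall x y, x * x + y * y < 1 -> exists d, 0 < d /\ forall r, 0 < r < d ->
    pot_law f1 x y r /\ pot_law f2 x y r).
  { intros x' y' H. exists ((1 - (x' * x' + y' * y')) / 3). split; [lra|].
    intros r Hr. split; apply pot_identities; try assumption; try lra;
      intros s t Hs; apply (small_circle_in_box x' y' r); lra. }
  assert (HM : circle_mvp u1 /\ circle_mvp u2).
  { split; intros x' y' H; destruct (Hlaw x' y' H) as (d & Hd & HL);
      destruct (HJ x' y' H) as (d' & Hd' & HJ');
      (exists (Rmin d d'); split; [now apply Rmin_pos|]; intros r Hr;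
       assert (Hr2 : 0 < r < d /\ r < d') by (revert Hr; unfold Rmin; destruct Rle_dec; lra);
       destruct (HL r (proj1 Hr2)) as [(L1 & L2 & _ & _) (M1 & M2 & _ & _)]).
    - unfold u1 at 1. rewrite circ_minus by assumption.
      assert (Z : RInt (fun s => circ f1 cos x' y' s) 0 r - RInt (fun s => circ f2 sin x' y' s) 0 r = 0).
      { rewrite <- RInt_Rminus by (apply ex_pot; assumption).
        rewrite (RInt_Rext _ (fun _ => 0)); [rewrite RInt_Rconst; ring | lra |].
        intros s Hs. exact (proj1 (HJ' s ltac:(lra))). }
      unfold u1. nra.
    - unfold u2 at 1. rewrite circ_plus by assumption.
      assert (Z : RInt (fun s => circ f1 sin x' y' s) 0 r + RInt (fun s => circ f2 cos x' y' s) 0 r = 0).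
      { rewrite <- RInt_Rplus by (apply ex_pot; assumption).
        rewrite (RInt_Rext _ (fun _ => 0)); [rewrite RInt_Rconst; ring | lra |].
        intros s Hs. exact (proj2 (HJ' s ltac:(lra))). }
      unfold u2. nra. }
  destruct HM as [M1 M2].
  set (v1 := fun t => u1 (cos t) (sin t)). set (v2 := fun t => u2 (cos t) (sin t)).
  assert (V1 : forall t, continuous v1 t) by (intros t; unfold v1; cont).
  assert (V2 : forall t, continuous v2 t) by (intros t; unfold v2; cont).
  assert (EU : forall x y, x * x + y * y < 1 ->
    expands u1 x y (/ PI * kernel_int ker_re v1 x y) (- / PI * kernel_int ker_im v1 x y) /\
    expands u2 x y (/ PI * kernel_int ker_re v2 x y) (- / PI * kernel_int ker_im v2 x y)).
  { intros x' y' H.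
    assert (G : forall u, cont2 u -> circle_mvp u ->
      (forall t, continuous (fun t => u (cos t) (sin t)) t) ->
      expands u x' y' (/ PI * kernel_int ker_re (fun t => u (cos t) (sin t)) x' y')
        (- / PI * kernel_int ker_im (fun t => u (cos t) (sin t)) x' y')).
    { intros u Hu Mu Cu.
      destruct (kernel_int_expands _ x' y' Cu H) as [E _].
      apply (expands_scal _ _ _ _ _ (/ (2 * PI))) in E.
      replace (/ PI) with (/ (2 * PI) * 2) by (field; lra).
      rewrite Rmult_assoc. rewrite <- Ropp_mult_distr_l, Rmult_assoc, Ropp_mult_distr_r,
        Ropp_mult_distr_l.
      revert E. apply expands_ext; [exact H|]. intros x0 y0 H0.
      rewrite poisson_representation by assumption. field. lra. }
    split; [exact (G u1 U1 M1 V1) | exact (G u2 U2 M2 V2)]. }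
  (* The product of [- 1 / (2 PI)], from the divergence law, and [1 / PI], from differentiating the
     Poisson integral. *)
  set (c := - / (2 * (PI * PI))).
  assert (F : forall x y, x * x + y * y < 1 ->
    c * (kernel_int ker_re v1 x y + -1 * kernel_int ker_im v2 x y) = f1 x y /\
    c * (kernel_int ker_re v2 x y + kernel_int ker_im v1 x y) = f2 x y).
  { intros x' y' H. destruct (EU x' y' H) as [E1 E2]. destruct (Hlaw x' y' H) as (d & Hd & HL).
    assert (D1 := divergence_at_point u1 u2 f1 x' y' _ _ _ _ d U1 U2 H1 E1 E2 Hd).
    (* The divergence of [(u1, u2)] recovers [f1]; that of the turned field [(u2, - u1)] recovers
       [f2]. In each, one density contributes its flux and the other its circulation, which is
       zero. *)
    assert (D2 := divergence_at_point u2 (fun x y => -1 * u1 x y) f2 x' y' _ _ _ _ d U2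
      (cont2_scal (-1) u1 U1) H2 E2 (expands_scal _ _ _ _ _ (-1) E1) Hd).
    assert (D1' : / PI * kernel_int ker_re v1 x' y' + - / PI * kernel_int ker_im v2 x' y'
      = - 2 * PI * f1 x' y').
    { apply D1. intros r Hr. destruct (HL r Hr) as [(_ & _ & L3 & L4) (_ & _ & N3 & N4)].
      unfold u1, u2. rewrite circ_minus, circ_plus by assumption.
      rewrite <- L3. lra. }
    assert (D2' : / PI * kernel_int ker_re v2 x' y' + -1 * (- / PI * kernel_int ker_im v1 x' y')
      = - 2 * PI * f2 x' y').
    { apply D2. intros r Hr. destruct (HL r Hr) as [(_ & _ & L3 & L4) (_ & _ & N3 & N4)].
      rewrite circ_scal by assumption.
      unfold u1, u2. rewrite circ_minus, circ_plus by assumption.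
      rewrite <- N3. lra. }
    unfold c. split.
    - replace (f1 x' y') with (- / (2 * PI) * (- 2 * PI * f1 x' y')) by (field; lra).
      rewrite <- D1'. field. lra.
    - replace (f2 x' y') with (- / (2 * PI) * (- 2 * PI * f2 x' y')) by (field; lra).
      rewrite <- D2'. field. lra. }
  destruct (kernel_int_expands v1 x y V1 Hxy) as (_ & R1 & I1).
  destruct (kernel_int_expands v2 x y V2 Hxy) as (_ & R2 & I2).
  exists (c * (kernel_int ker3_re v1 x y + -1 * kernel_int ker3_im v2 x y)),
    (c * (kernel_int ker3_re v2 x y + kernel_int ker3_im v1 x y)).
  split.
  - apply (expands_ext _ f1 x y _ _ Hxy (fun x y H => proj1 (F x y H))).
    replace (- _) with (c * (- kernel_int ker3_im v1 x y + -1 * kernel_int ker3_re v2 x y)) by ring.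
    now apply expands_scal, expands_plus, expands_scal.
  - apply (expands_ext _ f2 x y _ _ Hxy (fun x y H => proj2 (F x y H))).
    replace (c * (kernel_int ker3_re v1 x y + -1 * kernel_int ker3_im v2 x y))
      with (c * (- kernel_int ker3_im v2 x y + kernel_int ker3_re v1 x y)) by ring.
    now apply expands_scal, expands_plus.
Qed.

(** * Localisation and return to the complex plane *)

Definition cutoff (x : R) : R := (1 + Rabs (2 - Rabs x) - Rabs (1 - Rabs x)) / 2.

Lemma cutoff_1 (x : R) : Rabs x <= 1 -> cutoff x = 1.
Proof. intros H. unfold cutoff. rewrite !(Rabs_pos_eq (_ - _)); lra. Qed.

Lemma cutoff_0 (x : R) : 2 <= Rabs x -> cutoff x = 0.
Proof. intros H. unfold cutoff. rewrite !(Rabs_left1 (_ - _)); lra. Qed.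

Lemma continuous_cutoff (x : R) : continuous cutoff x.
Proof.
  assert (Cabs : forall t, continuous Rabs t) by (intros; apply continuous_Rabs).
  unfold cutoff, Rdiv. cont.
Qed.

(** Where a coordinate exceeds 2 in absolute value the product is locally zero, so the arbitrary
    values of [g] outside the square of half-side 3 do no harm. *)
Lemma cont2_cutoff (g : R -> R -> R) :
  (forall x y, Rabs x < 3 -> Rabs y < 3 ->
     continuous (fun q : R * R => g (fst q) (snd q)) (x, y)) ->
  cont2 (fun x y => cutoff x * cutoff y * g x y).
Proof.
  intros Hg [x y].
  assert (Cc := continuous_cutoff).
  assert (Z : forall w : R * R -> R, continuous w (x, y) -> 2 < w (x, y) ->
    (forall q, 2 < w q -> cutoff (fst q) * cutoff (snd q) * g (fst q) (snd q) = 0) ->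
    continuous (fun q => cutoff (fst q) * cutoff (snd q) * g (fst q) (snd q)) (x, y)).
  { intros w Cw Hw H0.
    eapply continuous_ext_loc; [|apply (continuous_const 0)].
    assert (Hp : 0 < w (x, y) - 2) by lra.
    generalize (proj1 (filterlim_locally _ _) Cw (mkposreal _ Hp)). apply filter_imp.
    intros q Hq. change (Rabs (w q - w (x, y)) < w (x, y) - 2) in Hq.
    symmetry. apply H0. apply Rabs_lt_between in Hq. lra. }
  destruct (Rlt_dec (Rabs x) 3) as [Hx|Hx]; [destruct (Rlt_dec (Rabs y) 3) as [Hy|Hy]|].
  - apply continuous_Rmult; [cont | now apply Hg].
  - apply (Z (fun q => Rabs (snd q))).
    + apply (continuous_comp snd Rabs); [apply continuous_snd | apply continuous_Rabs].
    + simpl. lra.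
    + intros q Hq. rewrite (cutoff_0 (snd q)) by lra. ring.
  - apply (Z (fun q => Rabs (fst q))).
    + apply (continuous_comp fst Rabs); [apply continuous_fst | apply continuous_Rabs].
    + simpl. lra.
    + intros q Hq. rewrite (cutoff_0 (fst q)) by lra. ring.
Qed.

Lemma cutoff_supp (g : R -> R -> R) : box_supp 2 (fun x y => cutoff x * cutoff y * g x y).
Proof. intros x y [H|H]; rewrite (cutoff_0 _ H); ring. Qed.

(** A boundary point has points outside [D] in every neighbourhood, so it cannot lie in the open set
    [D], hence not in a disc contained in [D]. *)
Lemma rho_positive (D : C -> Prop) (a : C) :
  open D -> D a -> exists d, 0 < d /\ forall r, r < d -> Rbar_lt r (rho D a).
Proof.
  intros HD Ha. destruct (HD a Ha) as [d Hd]. exists d. split; [apply cond_pos|].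
  intros r Hr. apply (Rbar_lt_le_trans r d); [exact Hr|].
  apply (proj2 (Glb_Rbar_correct _)). intros q (w & Hw & ->).
  apply Rnot_lt_le. intros H.
  assert (Dw : D w).
  (* Balls of [C] are coordinate squares here, and contain the disc of the same radius. *)
  { apply Hd. assert (H1 := Rabs_fst_le (w - a)%C). assert (H2 := Rabs_snd_le (w - a)%C).
    split; [change (Rabs (fst w - fst a) < d) | change (Rabs (snd w - snd a) < d)];
      simpl in H1, H2; unfold Rminus; lra. }
  destruct (Hw D (HD w Dw)) as [_ (w' & H1 & H2)]. now apply H2.
Qed.

Lemma J_components (f : C -> C) (a : C) (r : R) :
  (forall t, continuous (fun t => fst (f (a + r * expi t)%C)) t) ->
  (forall t, continuous (fun t => snd (f (a + r * expi t)%C)) t) ->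
  J f a r =
  (- r * RInt (fun t => fst (f (a + r * expi t)%C) * sin t + snd (f (a + r * expi t)%C) * cos t) 0 (2 * PI),
   r * RInt (fun t => fst (f (a + r * expi t)%C) * cos t - snd (f (a + r * expi t)%C) * sin t) 0 (2 * PI)).
Proof.
  intros H1 H2. unfold J. apply (is_RInt_unique (V := C_R_CompleteNormedModule)).
  apply (is_RInt_fct_extend_pair (U := R_NormedModule) (V := R_NormedModule)).
  - eapply (is_RInt_ext (V := R_NormedModule)); [|apply (is_RInt_scal (V := R_NormedModule)),
      (RInt_correct (V := R_CompleteNormedModule)), ex_RInt_cont; intros; cont].
    intros t _. unfold scal. simpl. unfold mult. simpl. ring.
  - eapply (is_RInt_ext (V := R_NormedModule)); [|apply (is_RInt_scal (V := R_NormedModule)),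
      (RInt_correct (V := R_CompleteNormedModule)), ex_RInt_cont; intros; cont].
    intros t _. unfold scal. simpl. unfold mult. simpl. ring.
Qed.

Lemma is_derive_quadratic (f : C -> C) (z l : C) (K d : R) :
  0 < d -> 0 <= K ->
  (forall w, Cmod (w - z)%C < d ->
     Cmod (f w - f z - (w - z) * l)%C <= K * (Cmod (w - z)%C * Cmod (w - z)%C)) ->
  is_derive (K := C_AbsRing) (V := C_NormedModule) f z l.
Proof.
  intros Hd HK H. split; [apply is_linear_scal_l|].
  intros x Hx eps.
  apply (is_filter_lim_locally_unique (V := AbsRing_NormedModule C_AbsRing)) in Hx. subst x.
  assert (He : 0 < Rmin d (eps / (K + 1))).
  { apply Rmin_pos; [exact Hd|]. apply Rdiv_lt_0_compat; [apply cond_pos | lra]. }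
  exists (mkposreal _ He). intros w Hw.
  change (Cmod (w - z)%C < Rmin d (eps / (K + 1))) in Hw.
  change (Cmod (f w - f z - (w - z) * l)%C <= eps * Cmod (w - z)%C).
  assert (Hw1 := Rlt_le_trans _ _ _ Hw (Rmin_l _ _)).
  assert (Hw2 := Rlt_le_trans _ _ _ Hw (Rmin_r _ _)).
  eapply Rle_trans; [now apply H|]. rewrite <- Rmult_assoc.
  apply Rmult_le_compat_r; [apply Cmod_ge_0|].
  assert (E : eps / (K + 1) * (K + 1) = eps) by (field; lra).
  assert (P := Cmod_ge_0 (w - z)%C). nra.
Qed.

Lemma Cmod_le_abs (z : C) : Cmod z <= Rabs (fst z) + Rabs (snd z).
Proof.
  destruct z as [a b]. rewrite Cmod_pair. simpl.
  assert (Pa := Rabs_pos a). assert (Pb := Rabs_pos b).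
  rewrite <- (sqrt_square (Rabs a + Rabs b)) by lra. apply sqrt_le_1_alt.
  assert (Ea : a * a = Rabs a * Rabs a) by (rewrite <- Rabs_mult, Rabs_pos_eq; nra).
  assert (Eb : b * b = Rabs b * Rabs b) by (rewrite <- Rabs_mult, Rabs_pos_eq; nra).
  nra.
Qed.

Lemma continuous_on_open (D : C -> Prop) (f : C -> C) (z : C) :
  open D -> continuous_on D f -> D z -> continuous f z.
Proof.
  intros HD Hf Hz P HP. assert (H := Hf z Hz P HP).
  unfold filtermap, within in *. generalize (filter_and _ _ H (HD z Hz)).
  apply filter_imp. intros w [H1 H2]. now apply H1.
Qed.

Theorem corollary1p2 (D : C -> Prop) (f : C -> C)
  (D_domain : is_domain D)
  (f_cont : continuous_on D f)
  (f_J : forall a : C, D a ->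
     exists delta : R, 0 < delta /\
       forall r : R, 0 < r -> Rbar_lt r (Rbar_min delta (rho D a)) ->
         J f a r = RtoC 0) :
  holomorphic_on D f.
Proof.
  intros z0 Hz0. destruct D_domain as [HD _].
  destruct (HD z0 Hz0) as [eps Heps].
  assert (Hep := cond_pos eps).
  (* The chart [Z] then maps the open square of half-side 3 into the neighbourhood of [z0] contained
     in [D]. *)
  set (p := eps / 3). assert (Hp : 0 < p) by (unfold p; lra).
  set (Z := fun x y : R => (fst z0 + p * x, snd z0 + p * y) : C).
  assert (HZ : forall x y, Rabs x < 3 -> Rabs y < 3 -> D (Z x y)).
  { assert (Hball : forall t, Rabs t < 3 -> Rabs (p * t) < eps).
    { intros t Ht. rewrite Rabs_mult, (Rabs_pos_eq p) by lra. unfold p. nra. }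
    intros x y Hx Hy. apply Heps. split;
      [change (Rabs (fst z0 + p * x - fst z0) < eps)
      | change (Rabs (snd z0 + p * y - snd z0) < eps)];
      rewrite Rplus_minus_l; now apply Hball. }
  assert (CF : forall x y, Rabs x < 3 -> Rabs y < 3 ->
    continuous (fun q : R * R => f (Z (fst q) (snd q))) (x, y)).
  { intros x y Hx Hy.
    apply (continuous_comp (fun q : R * R => Z (fst q) (snd q)) f).
    - unfold Z. cont.
    - apply (continuous_on_open D); auto. }
  set (f1 := fun x y => cutoff x * cutoff y * fst (f (Z x y))).
  set (f2 := fun x y => cutoff x * cutoff y * snd (f (Z x y))).
  assert (H1 : cont2 f1).
  { apply (cont2_cutoff (fun x y => fst (f (Z x y)))). intros x y Hx Hy.
    apply continuous_fst_comp. now apply CF. }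
  assert (H2 : cont2 f2).
  { apply (cont2_cutoff (fun x y => snd (f (Z x y)))). intros x y Hx Hy.
    apply continuous_snd_comp. now apply CF. }
  assert (Ef : forall x y, Rabs x <= 1 -> Rabs y <= 1 -> f (Z x y) = (f1 x y, f2 x y)).
  { intros x y Hx Hy. unfold f1, f2. rewrite !cutoff_1, !Rmult_1_l by assumption.
    apply surjective_pairing. }
  assert (HJ : forall x y, x * x + y * y < 1 -> exists delta, 0 < delta /\ forall r, 0 < r < delta ->
     circ f1 cos x y r - circ f2 sin x y r = 0 /\
     circ f1 sin x y r + circ f2 cos x y r = 0).
  { intros x y Hxy.
    assert (Dz : D (Z x y)).
    { apply HZ; [|]; apply Rabs_lt_between; nra. }
    destruct (f_J _ Dz) as (dl & Hdl & HJ).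
    destruct (rho_positive D _ HD Dz) as (d & Hd & Hrho).
    (* The first bound, rescaled by [p], keeps the circle within the hypothesis and below [rho]; the
       second keeps it in the unit disc, where the cutoff is 1. *)
    exists (Rmin (Rmin dl d / p) ((1 - (x * x + y * y)) / 3)).
    split; [apply Rmin_pos; [apply Rdiv_lt_0_compat; [now apply Rmin_pos | exact Hp] | lra]|].
    intros r Hr.
    assert (Hr1 : 0 < r /\ r < Rmin dl d / p /\ x * x + y * y + 3 * r <= 1).
    { revert Hr. unfold Rmin at 1. destruct Rle_dec; lra. }
    destruct Hr1 as (Hr0 & Hr1 & Hr2).
    apply Rlt_div_r in Hr1; [|exact Hp].
    assert (Hpr : 0 < p * r) by now apply Rmult_lt_0_compat.
    assert (J0 : J f (Z x y) (p * r) = RtoC 0).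
    { apply HJ; [exact Hpr|].
      assert (L1 : p * r < dl) by (assert (Q := Rmin_l dl d); lra).
      assert (L2 : Rbar_lt (p * r) (rho D (Z x y)))
        by (apply Hrho; assert (Q := Rmin_r dl d); lra).
      unfold Rbar_min. destruct (rho D (Z x y)) as [q| |]; simpl in *;
        [apply Rmin_case; assumption | exact L1 | exact L2]. }
    assert (Eq : forall t, f (Z x y + (p * r)%R * expi t)%C
      = (f1 (x + r * cos t) (y + r * sin t), f2 (x + r * cos t) (y + r * sin t))).
    { intros t. destruct (small_circle_in_box x y r r t ltac:(lra) Hr2) as [B1 B2].
      rewrite <- Ef by assumption. f_equal. unfold Z, Cplus, Cmult, RtoC, expi. simpl.
      f_equal; ring. }
    rewrite J_components in J0.
    - assert (Jf := f_equal fst J0). assert (Js := f_equal snd J0). simpl in Jf, Js.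
      apply Rmult_integral in Jf, Js.
      destruct Jf as [Jf|Jf]; [lra|]. destruct Js as [Js|Js]; [lra|].
      assert (C1c := ex_circ f1 cos x y r H1 continuous_cos).
      assert (C1s := ex_circ f1 sin x y r H1 continuous_sin).
      assert (C2c := ex_circ f2 cos x y r H2 continuous_cos).
      assert (C2s := ex_circ f2 sin x y r H2 continuous_sin).
      unfold circ. rewrite <- RInt_Rminus, <- RInt_Rplus by assumption.
      (* The factor [i] in [i r e^(it)] swaps the roles: the imaginary part of [J] gives the first
         identity, the real part the second. *)
      split; [eapply eq_trans; [|exact Js] | eapply eq_trans; [|exact Jf]]; apply RInt_Rext;
        try apply two_PI_pos; intros t _; rewrite Eq; reflexivity.
    - intros t. apply (continuous_ext (fun t => f1 (x + r * cos t) (y + r * sin t))).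
      + intros u. now rewrite Eq.
      + cont.
    - intros t. apply (continuous_ext (fun t => f2 (x + r * cos t) (y + r * sin t))).
      + intros u. now rewrite Eq.
      + cont. }
  destruct (small_circles_imply_differentiable f1 f2 0 0 H1 H2) as (a & b & E1 & E2);
    [apply cutoff_supp | apply cutoff_supp | exact HJ | lra |].
  destruct E1 as (K1 & d1 & Hd1 & E1). destruct E2 as (K2 & d2 & Hd2 & E2).
  set (d := Rmin (Rmin d1 d2) 1).
  assert (Hd : 0 < d) by (repeat apply Rmin_pos; lra).
  (* Division by [p] undoes the rescaling of the chart. *)
  exists ((a / p, b / p) : C).
  (* The absolute value supplies the nonnegative constant, since [expands] does not fix the sign of
     its own. *)
  apply (is_derive_quadratic f z0 _ (Rabs (K1 + K2) / (p * p)) (p * d)).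
  - now apply Rmult_lt_0_compat.
  - apply Rdiv_le_0_compat; [apply Rabs_pos | now apply Rmult_lt_0_compat].
  - intros w Hw.
    set (h := (fst w - fst z0) / p). set (l := (snd w - snd z0) / p).
    assert (Ew : w = Z h l).
    { unfold Z, h, l. rewrite (surjective_pairing w) at 1. f_equal; field; lra. }
    assert (Ez : z0 = Z 0 0).
    { unfold Z. rewrite (surjective_pairing z0) at 1. f_equal; ring. }
    assert (Ed : (w - z0)%C = (p * (h, l))%C).
    { rewrite Ew, Ez at 1. unfold Z, Cminus, Cplus, Copp, Cmult, RtoC. simpl. f_equal; ring. }
    assert (EM : Cmod (w - z0)%C = p * Cmod (h, l)).
    { rewrite Ed, Cmod_mult, Cmod_R, Rabs_pos_eq by lra. reflexivity. }
    rewrite EM in *. apply Rmult_lt_reg_l in Hw; [|exact Hp].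
    assert (Hhl : Cmod (h, l) <= d1 /\ Cmod (h, l) <= d2 /\ Cmod (h, l) <= 1).
    { revert Hw. unfold d, Rmin. repeat destruct Rle_dec; lra. }
    destruct Hhl as (Q1 & Q2 & Q3).
    assert (Rh : Rabs h <= 1) by (eapply Rle_trans; [apply (Rabs_fst_le (h, l)) | exact Q3]).
    assert (Rl : Rabs l <= 1) by (eapply Rle_trans; [apply (Rabs_snd_le (h, l)) | exact Q3]).
    specialize (E1 h l Q1). specialize (E2 h l Q2).
    rewrite !Rplus_0_l in E1, E2.
    assert (EF : (f w - f z0 - (w - z0) * ((a / p)%R, (b / p)%R))%C
      = (f1 h l - f1 0 0 - (h * a + l * - b), f2 h l - f2 0 0 - (h * b + l * a))).
    { rewrite Ed. rewrite Ew, Ez at 1.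
      rewrite !Ef by (try assumption; rewrite Rabs_R0; lra).
      unfold Cminus, Cplus, Copp, Cmult, RtoC. simpl. f_equal; field; lra. }
    rewrite EF. eapply Rle_trans; [apply Cmod_le_abs|]. simpl.
    replace (Rabs (K1 + K2) / (p * p) * (p * Cmod (h, l) * (p * Cmod (h, l))))
      with (Rabs (K1 + K2) * (Cmod (h, l) * Cmod (h, l))) by (field; lra).
    rewrite Cmod_pair_sqr.
    assert (Hn : 0 <= h * h + l * l) by nra.
    assert (HK := Rle_abs (K1 + K2)). nra.
Qed.
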